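(* Let $G$ and $G'$ be two groups, $A$ a $G$-graded $k$-algebra, $A'$ a $G'$-graded $k$-algebra, $X$ a right $G$-set, and $X'$ a right $G'$-set. For a pair of $k$-linear functors $S:gr\text{-}(A,X,G)\to gr\text{-}(A',X',G')$ and $T:gr\text{-}(A',X',G')\to gr\text{-}(A,X,G)$, the following statements are equivalent: (a) $(S,T)$ is a Frobenius pair; (b) there exist an $X\times X'$-graded $(A,A')$-bimodule $M$ and an $X'\times X$-graded $(A',A)$-bimodule $N$ with the following properties: (1) ${}_xM$ and $N_x$ are finitely generated projective in $\mathcal{M}_{A'}$ and ${}_{A'}\mathcal{M}$ respectively, for every $x\in X$, and $M_{x'}$ and ${}_{x'}N$ are finitely generated projective in ${}_A\mathcal{M}$ and $\mathcal{M}_A$ respectively, for every $x'\in X'$; (2) $\mathrm{H}({}_AM,A)\simeq N$ as $X'\times X$-graded $(A',A)$-bimodules, and $\mathrm{H}({}_{A'}N,A')\simeq M$ as $X\times X'$-graded $(A,A')$-bimodules; (3) $S\simeq-\widehat{\otimes}_AM$ and $T\simeq-\widehat{\otimes}_{A'}N$.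
   Context: $k$ is a commutative ring. $(S,T)$ is a Frobenius pair if $T$ is both a left and a right adjoint of $S$. $gr\text{-}(A,X,G)$: right $A$-modules $M=\bigoplus_{x\in X}M_x$ with $M_xA_g\subset M_{xg}$; morphisms are $A$-linear maps preserving the grading. The right $G$-set $X$ is a left $G$-set via $g.x=xg^{-1}$. $(G,X,A)\text{-}gr$: left $A$-modules $N=\bigoplus_{x\in X}{}_xN$ with $A_g\,{}_xN\subset{}_{g.x}N$. An $X\times X'$-graded $(A,A')$-bimodule is an $(A,A')$-bimodule $P=\bigoplus P_{(x,x')}$ with $A_gP_{(x,x')}A'_{g'}\subset P_{(g.x,\,x'g')}$. Put ${}_xP=\bigoplus_{x'}P_{(x,x')}$ and $P_{x'}=\bigoplus_xP_{(x,x')}$. $X'\times X$-graded $(A',A)$-bimodules are defined in the same way, with $N_x=\bigoplus_{x'}N_{(x',x)}$ and ${}_{x'}N=\bigoplus_xN_{(x',x)}$. For $M\in gr\text{-}(A,X,G)$ and $N\in(G,X,A)\text{-}gr$, $M\widehat\otimes_AN$ is the $k$-submodule of $M\otimes_AN$ generated by all $m\otimes n$ with $m\in M_x$, $n\in{}_xN$, $x\in X$. For an $X\times X'$-graded $(A,A')$-bimodule $P$, $-\widehat\otimes_AP:gr\text{-}(A,X,G)\to gr\text{-}(A',X',G')$ has grading $(M\widehat\otimes_AP)_{x'}=M\widehat\otimes_AP_{x'}$. For an $X'\times X$-graded $(A',A)$-bimodule $N$ with all $N_x$ finitely generated projective in ${}_{A'}\mathcal M$, $\mathrm H({}_{A'}N,A')$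 is the set of left $A'$-linear maps $f:N\to A'$ with $f(N_x)=0$ for almost all $x\in X$, with $(af)(n)=f(na)$, $(fa')(n)=f(n)a'$; it is an $X\times X'$-graded $(A,A')$-bimodule whose component of degree $(x,x')$ consists of the $f$ with $f(N_y)=0$ for $y\neq x$ and $f({}_{y'}N)\subset\bigoplus\{A'_{g'}: g'\in G',\ y'g'=x'\}$ for all $y'\in X'$. $\mathrm H({}_AM,A)$ is defined in the same way with the roles of $(A,X,G)$ and $(A',X',G')$ exchanged. *)

(* Defs.v *)
From HB Require Import structures.
From mathcomp Require Import all_boot all_algebra.
From mathcomp Require Import boolp classical_sets functions cardinality.
From mathcomp Require Import freeg.

Set Implicit Arguments.
Unset Strict Implicit.
Unset Printing Implicit Defensive.

Import GRing.Theory.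
Local Open Scope classical_set_scope.
Local Open Scope ring_scope.

Section InternalSums.
Context {I : Type} {V : zmodType}.

Definition subgroup (U : set V) : Prop :=
  U 0 /\ forall x y, U x -> U y -> U (x - y).

(* The sum of the family [C] over the indices in [J]. *)
Inductive isum (C : I -> set V) (J : set I) : set V :=
| isum0 : isum C J 0
| isumC i c v : J i -> C i c -> isum C J v -> isum C J (c + v).

Definition direct_sum (C : I -> set V) : Prop :=
  [/\ forall i, subgroup (C i),
      forall v, isum C setT v
    & forall i v, C i v -> isum C [set j | j <> i] v -> v = 0].

Lemma subgroupN U x : subgroup U -> U x -> U (- x).
Proof. by move=> [U0 UB] Ux; rewrite -sub0r; apply: UB. Qed.

Lemma subgroupD U x y : subgroup U -> U x -> U y -> U (x + y).
Proof.
by move=> sU Ux Uy; rewrite -[y]opprK; apply: sU.2 => //; apply: subgroupN.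
Qed.

Lemma isum_elt C (J : set I) i c : J i -> C i c -> isum C J c.
Proof. by move=> Ji Cc; rewrite -[c]addr0; apply: isumC Ji Cc (isum0 _ _). Qed.

Lemma isumD C J v w : isum C J v -> isum C J w -> isum C J (v + w).
Proof.
elim=> [|i c u Ji Cc _ IH] Hw; first by rewrite add0r.
by rewrite -addrA; apply: isumC Ji Cc (IH Hw).
Qed.

Lemma isumN C J v : (forall i, subgroup (C i)) ->
  isum C J v -> isum C J (- v).
Proof.
move=> sC; elim=> [|i c u Ji Cc _ IH]; first by rewrite oppr0; apply: isum0.
by rewrite opprD; apply: isumC Ji _ IH; apply: subgroupN.
Qed.

Lemma isum_subgroup C J : (forall i, subgroup (C i)) -> subgroup (isum C J).
Proof.
by move=> sC; split=> [|x y Hx Hy]; [apply: isum0|apply/isumD/isumN].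
Qed.

Lemma isumS (C : I -> set V) (J K : set I) :
  J `<=` K -> isum C J `<=` isum C K.
Proof.
move=> sJK v; elim=> [|i c u Ji Cc _ IH]; first exact: isum0.
exact: isumC (sJK _ Ji) Cc IH.
Qed.

End InternalSums.

Lemma isum_map I I' (V W : zmodType) (C : I -> set V) (D : I' -> set W)
    (J : set I) (K : set I') (f : V -> W) :
  f 0 = 0 -> {morph f : x y / x + y} ->
  (forall i c, J i -> C i c -> isum D K (f c)) ->
  forall v, isum C J v -> isum D K (f v).
Proof.
move=> f0 fD fC v; elim=> [|i c u Ji Cc _ IH]; first by rewrite f0; apply: isum0.
by rewrite fD; apply: isumD => //; apply: fC Cc.
Qed.

Section DirectSums.
Context {I : choiceType} {V : zmodType} (C : I -> set V) (dC : direct_sum C).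

Lemma isum_normal J v : isum C J v -> exists (s : seq I) (u : I -> V),
  [/\ uniq s, forall i, i \in s -> J i, forall i, C i (u i)
    & v = \sum_(i <- s) u i].
Proof.
have [sC _ _] := dC.
suff H : isum C J v -> exists (s : seq I) (u : I -> V),
    [/\ uniq s, forall i, i \in s -> J i, forall i, C i (u i),
    forall i, i \notin s -> u i = 0 & v = \sum_(i <- s) u i].
  by move=> /H[s [u [? ? ? _ ?]]]; exists s, u.
elim=> [|i c w Ji Cc _ [s [u [us sJ uC u0 ->]]]].
  exists [::], (fun=> 0); rewrite big_nil; split=> // i; exact: (sC i).1.
have [si|si] := boolP (i \in s).
  exists s, (fun j => (if j == i then c else 0) + u j); split=> //.
  - move=> j; apply: subgroupD => //; case: eqP => [->|_] //; exact: (sC j).1.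
  - move=> j sj; rewrite u0 // addr0; case: eqP sj si => // -> /negP //.
  - rewrite big_split /=; congr (_ + _).
    rewrite (bigD1_seq i) //= eqxx big1 ?addr0 // => j /negPf -> //.
exists (i :: s), (fun j => (if j == i then c else 0) + u j); split=> //=.
- by rewrite si.
- by move=> j; rewrite inE => /predU1P[->|/sJ].
- move=> j; apply: subgroupD => //; case: eqP => [->|_] //; exact: (sC j).1.
- by move=> j; rewrite inE negb_or => /andP[/negPf -> /u0 ->]; rewrite addr0.
- rewrite big_cons eqxx (u0 _ si) addr0; congr (_ + _); apply: eq_big_seq => j sj.
  rewrite (_ : (j == i) = false) ?add0r //.
  by apply/eqP => E; rewrite -E sj in si.
Qed.

Lemma isum_disj J v : isum C J v -> isum C (~` J) v -> v = 0.
Proof.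
have [sC _ C0] := dC => Jv Jv'.
have [s [u [us sJ uC Ev]]] := isum_normal Jv; rewrite Ev.
rewrite big_seq big1 // => i si; apply: (C0 i) (uC i) _.
have -> : u i = v - \sum_(j <- s | j != i) u j.
  by rewrite Ev (bigD1_seq i) //= addrK.
apply: (isum_subgroup _ sC).2.
  by apply: isumS Jv' => j /= nJj E; apply: nJj; rewrite E; apply: sJ.
elim: (s) => [|j r IH]; first by rewrite big_nil; apply: isum0.
rewrite big_cons; case: ifP => // /eqP ji.
apply: (@isumC _ _ C _ j _ _ ji (uC j) IH).
Qed.

Lemma isum_split J v :
  exists a, isum C J a /\ isum C (~` J) (v - a).
Proof.
have [_ /(_ v) + _] := dC; elim=> [|i c w _ Cc _ [a [Ja Ja']]].
  by exists 0; rewrite subrr; split; apply: isum0.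
have [Ji|Ji] := pselect (J i).
  exists (c + a); split; first exact: isumC Ji Cc Ja.
  by rewrite opprD addrACA subrr add0r.
by exists a; split=> //; rewrite -addrA; apply: (@isumC _ _ C (~` J) i).
Qed.

End DirectSums.

(* The component of [v] in the partial sum of [C] over [J]. *)
Definition dproj I (V : zmodType) (C : I -> set V) (J : set I) (v : V) : V :=
  xget 0 [set a | isum C J a /\ isum C (~` J) (v - a)].

Section DirectProj.
Context {I : choiceType} {V : zmodType} (C : I -> set V) (dC : direct_sum C).
Variable J : set I.

Lemma dprojP v : isum C J (dproj C J v) /\ isum C (~` J) (v - dproj C J v).
Proof.
have [a Ha] := isum_split dC J v.
have : exists b, isum C J b /\ isum C (~` J) (v - b) by exists a.
exact: (@xgetPex _ 0 [set b | isum C J b /\ isum C (~` J) (v - b)]).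
Qed.

Lemma dproj_eq v a : isum C J a -> isum C (~` J) (v - a) -> dproj C J v = a.
Proof.
have [sC _ _] := dC; have [Jp Jp'] := dprojP v => Ja Ja'.
apply/eqP; rewrite -subr_eq0; apply/eqP/(isum_disj dC (J := J)).
  exact: (isum_subgroup _ sC).2.
have -> : dproj C J v - a = (v - a) - (v - dproj C J v).
  by rewrite opprB [RHS]addrC subrKA.
exact: (isum_subgroup _ sC).2.
Qed.

Lemma dprojD : {morph dproj C J : v w / v + w}.
Proof.
move=> v w; have [Jv Jv'] := dprojP v; have [Jw Jw'] := dprojP w.
by apply: dproj_eq; [apply: isumD|rewrite opprD addrACA; apply: isumD].
Qed.

Lemma dproj_id v : isum C J v -> dproj C J v = v.
Proof. by move=> Jv; apply: dproj_eq => //; rewrite subrr; apply: isum0. Qed.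

Lemma dproj_0 v : isum C (~` J) v -> dproj C J v = 0.
Proof. by move=> Jv; apply: dproj_eq; [apply: isum0|rewrite subr0]. Qed.

End DirectProj.

(* A k-algebra is a ring with a central structure map from k (the library's
   [algType] would exclude the zero ring). *)
Record kalg (k : comPzRingType) := KAlg {
  kalg_ring :> pzRingType;
  kin : {rmorphism k -> kalg_ring};
  kinC : forall c a, kin c * a = a * kin c }.

Record galg (k : comPzRingType) (G : groupType) := GAlg {
  galg_alg :> kalg k;
  gcomp : G -> set galg_alg;
  gcomp_sum : direct_sum gcomp;
  gcompZ : forall c g a, gcomp g a -> gcomp g (kin galg_alg c * a);
  gcomp1 : gcomp 1%g 1; (* a consequence of the other axioms *)
  gcompM : forall g h a b,
    gcomp g a -> gcomp h b -> gcomp (g * h)%g (a * b) }.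

Arguments gcomp {k G} _ _ _.

Record rset (G : groupType) := RSet {
  rset_car :> choiceType;
  ract : rset_car -> G -> rset_car;
  ract1 : forall x, ract x 1%g = x;
  ractM : forall x g h, ract x (g * h)%g = ract (ract x g) h }.

Definition lact (G : groupType) (X : rset G) (g : G) (x : X) : X := ract x g^-1%g.

(* A right R-module is a left module over the converse ring. *)
Definition rscale (R : pzRingType) (M : lmodType R^c) (m : M) (a : R) : M :=
  (a : R^c) *: m.

Notation "m :* a" := (rscale m a) : ring_scope.

Section RightModules.
Context {R : pzRingType} {M : lmodType R^c}.
Implicit Types (m n : M) (a b : R).

Lemma rscaleDl m n a : (m + n) :* a = m :* a + n :* a.
Proof. exact: scalerDr. Qed.
Lemma rscaleDr m a b : m :* (a + b) = m :* a + m :* b.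
Proof. exact: scalerDl. Qed.
Lemma rscaleM m a b : m :* (a * b) = m :* a :* b.
Proof. by rewrite /rscale scalerA. Qed.
Lemma rscale1 m : m :* 1 = m.
Proof. exact: scale1r. Qed.
Lemma rscale0 m : m :* 0 = 0.
Proof. exact: scale0r. Qed.
Lemma rscale0l a : (0 : M) :* a = 0.
Proof. exact: scaler0. Qed.
Lemma rscaleNl m a : (- m) :* a = - (m :* a).
Proof. exact: scalerN. Qed.
End RightModules.

Record submod (R : pzRingType) (V : lmodType R) := SubMod {
  submod_set :> V -> Prop;
  submod0 : submod_set 0;
  submodD : forall v w, submod_set v -> submod_set w -> submod_set (v + w);
  submodZ : forall a v, submod_set v -> submod_set (a *: v) }.

Section SubModules.
Context {R : pzRingType} {V : lmodType R} (U : submod V).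

Definition submod_pred : {pred V} := fun v => `[< U v >].

Lemma submod_pred_closed : submod_closed submod_pred.
Proof.
split=> [|a v w /asboolP Uv /asboolP Uw]; apply/asboolP; first exact: submod0.
by apply: submodD => //; apply: submodZ.
Qed.

HB.instance Definition _ :=
  GRing.isSubmodClosed.Build R V submod_pred submod_pred_closed.

Record submod_of := SubModOf { submod_val :> V; _ : submod_val \in submod_pred }.

HB.instance Definition _ := [isSub for submod_val].
HB.instance Definition _ := [Choice of submod_of by <:].
HB.instance Definition _ := [SubChoice_isSubLmodule of submod_of by <:].

Definition submod_mk v (Uv : U v) : submod_of :=
  SubModOf (introT (asboolP _) Uv).

Lemma submod_valP (u : submod_of) : U (submod_val u).
Proof. by case: u => v /= /asboolP. Qed.

Lemma submod_valD (u v : submod_of) :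
  submod_val (u + v) = submod_val u + submod_val v.
Proof. by []. Qed.

Lemma submod_valZ a (u : submod_of) : submod_val (a *: u) = a *: submod_val u.
Proof. by []. Qed.

End SubModules.

Section FgProj.
Context {R : pzRingType}.

Definition fin_gen (V : lmodType R) : Prop :=
  exists (n : nat) (e : 'I_n -> V),
    forall v, exists c : 'I_n -> R, v = \sum_(i < n) c i *: e i.

Definition projective (P : lmodType R) : Prop :=
  forall (V W : lmodType R) (g : {linear V -> W}) (f : {linear P -> W}),
    (forall w, exists v, g v = w) ->
    exists h : {linear P -> V}, forall p, g (h p) = f p.

Definition fgproj (V : lmodType R) : Prop := fin_gen V /\ projective V.

End FgProj.

(* For [e], the set of k-linear combinations of its elements. *)
Inductive kspan (k : pzRingType) (V : lmodType k) (E : set V) : set V :=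
| kspan0 : kspan E 0
| kspanC c e v : E e -> kspan E v -> kspan E (c *: e + v).

Section KSpan.
Context {k : pzRingType} {V : lmodType k}.
Implicit Types E F : set V.

Lemma kspan_elt E e : E e -> kspan E e.
Proof. by move=> Ee; rewrite -[e]addr0 -[e]scale1r; apply/kspanC/kspan0. Qed.

Lemma kspanD E v w : kspan E v -> kspan E w -> kspan E (v + w).
Proof.
by elim=> [|c e u Ee _ IH] Hw; rewrite ?add0r // -addrA; apply: kspanC (IH Hw).
Qed.

Lemma kspanZ E c v : kspan E v -> kspan E (c *: v).
Proof.
elim=> [|d e u Ee _ IH]; first by rewrite scaler0; apply: kspan0.
by rewrite scalerDr scalerA; apply: kspanC.
Qed.

End KSpan.

Section Tensor.
Context {R : pzRingType} (M : lmodType R^c) (N : lmodType R).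

(* The relators of M \ot_R N in the free abelian group on M * N. *)
Inductive tens_rel : {freeg (M * N) / int} -> Prop :=
| tens_rel0 : tens_rel 0
| tens_relB s t : tens_rel s -> tens_rel t -> tens_rel (s - t)
| tens_relDl m m' n :
    tens_rel (<< (m + m', n) >> - << (m, n) >> - << (m', n) >>)
| tens_relDr m n n' :
    tens_rel (<< (m, n + n') >> - << (m, n) >> - << (m, n') >>)
| tens_relA m a n : tens_rel (<< (m :* a, n) >> - << (m, a *: n) >>).

Definition tens_pred : {pred {freeg (M * N) / int}} :=
  fun t => `[< tens_rel t >].

Lemma tens_pred_closed : zmod_closed tens_pred.
Proof.
split=> [|s t /asboolP Hs /asboolP Ht]; apply/asboolP; first exact: tens_rel0.
exact: tens_relB.
Qed.

HB.instance Definition _ :=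
  GRing.isZmodClosed.Build {freeg (M * N) / int} tens_pred tens_pred_closed.

Definition tens := Quotient.quot tens_pred.

HB.instance Definition _ := GRing.Zmodule.on tens.

Definition tens_pi : {freeg (M * N) / int} -> tens := \pi_(tens)%qT.

Definition tens_mk (m : M) (n : N) : tens := tens_pi << (m, n) >>.

Lemma tens_piB : {morph tens_pi : s t / s - t}.
Proof. exact: raddfB. Qed.

Lemma tens_pi_eq s t : tens_pi s = tens_pi t <-> tens_rel (s - t).
Proof.
split=> [/eqP|H]; last apply/eqP; rewrite /tens_pi -Quotient.idealrBE.
  by move/asboolP.
exact/asboolP.
Qed.

End Tensor.

Notation "m \ot n" := (tens_mk m n) (at level 40, no associativity) : ring_scope.

Section TensorTheory.
Context {R : pzRingType} {M : lmodType R^c} {N : lmodType R}.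
Implicit Types (m : M) (n : N) (t : tens M N).

Lemma tens_rel_pi (s : {freeg (M * N) / int}) : tens_rel s -> tens_pi s = 0.
Proof.
have <- : tens_pi (0 : {freeg (M * N) / int}) = 0 by apply: raddf0.
by move=> Hs; apply/tens_pi_eq; rewrite subr0.
Qed.

Lemma tens_mkDl m m' n : (m + m') \ot n = m \ot n + m' \ot n.
Proof.
apply/eqP; rewrite -subr_eq0 opprD addrA -!tens_piB; apply/eqP.
by apply: tens_rel_pi; apply: tens_relDl.
Qed.

Lemma tens_mkDr m n n' : m \ot (n + n') = m \ot n + m \ot n'.
Proof.
apply/eqP; rewrite -subr_eq0 opprD addrA -!tens_piB; apply/eqP.
by apply: tens_rel_pi; apply: tens_relDr.
Qed.

Lemma tens_mkA m a n : (m :* a) \ot n = m \ot (a *: n).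
Proof. by apply/tens_pi_eq; apply: tens_relA. Qed.

Lemma tens_mk0l n : (0 : M) \ot n = 0.
Proof. by apply: (@addIr _ (0 \ot n)); rewrite -tens_mkDl !add0r. Qed.

Lemma tens_mk0r m : m \ot (0 : N) = 0.
Proof. by apply: (@addIr _ (m \ot 0)); rewrite -tens_mkDr !add0r. Qed.

Lemma tens_mkNl m n : (- m) \ot n = - (m \ot n).
Proof. by apply/eqP; rewrite -addr_eq0 -tens_mkDl addNr tens_mk0l. Qed.

Lemma tens_ind (P : tens M N -> Prop) :
  P 0 -> (forall m n t, P t -> P (m \ot n + t)) -> forall t, P t.
Proof.
move=> P0 PD t; rewrite -[t]reprK -/(tens_pi _) -[repr t]freeg_sumE.
elim: (dom _) => [|z s IH].
  by rewrite big_nil (_ : tens_pi 0 = 0) //; apply: raddf0.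
rewrite big_cons (_ : tens_pi _ = tens_pi << coeff z (repr t) *g z >> +
  tens_pi (\sum_(y <- s) << coeff y (repr t) *g y >>)); last exact: raddfD.
have -> : << coeff z (repr t) *g z >> = << z >> *~ coeff z (repr t).
  by rewrite freegU_mulz intz.
move: IH; set u := tens_pi (\sum_(y <- s) _).
have -> (c : int) : tens_pi (<< z >> *~ c) = (z.1 \ot z.2) *~ c.
  by rewrite /tens_mk -surjective_pairing; apply: raddfMz.
case: (coeff _ _) => n Pu; rewrite ?NegzE ?mulrNz -?pmulrn.
  by elim: n => [|n IH]; rewrite ?mulr0n ?add0r // mulrS -addrA; apply: PD.
rewrite -mulNrn -tens_mkNl.
by elim: n.+1 => [|j IH]; rewrite ?mulr0n ?add0r // mulrS -addrA; apply: PD.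
Qed.

Record balanced (V : zmodType) (f : M -> N -> V) : Prop := Balanced {
  balancedDl : forall m m' n, f (m + m') n = f m n + f m' n;
  balancedDr : forall m n n', f m (n + n') = f m n + f m n';
  balancedA : forall m a n, f (m :* a) n = f m (a *: n) }.

(* The map induced by [f]; meaningful when [f] is balanced. *)
Definition tens_lift (V : zmodType) (f : M -> N -> V) (t : tens M N) : V :=
  fglift (fun p => f p.1 p.2 : zmodule V) (repr t).

Section Lift.
Context {V : zmodType} (f : M -> N -> V) (bf : balanced f).

Let F : {freeg (M * N) / int} -> V := fglift (fun p => f p.1 p.2 : zmodule V).

Let FB : {morph F : s t / s - t}.
Proof. exact: (@lift_is_additive int _ (zmodule V)). Qed.

Let F1 m n : F << (m, n) >> = f m n.
Proof. by rewrite /F liftU scale1r. Qed.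

Let F0 s : tens_rel s -> F s = 0.
Proof.
elim=> [|s' t' _ IHs _ IHt|m m' n|m n n'|m a n].
- by have := FB 0 0; rewrite !subrr.
- by rewrite FB IHs IHt subrr.
- by rewrite !FB !F1 (balancedDl bf) addrAC addrK subrr.
- by rewrite !FB !F1 (balancedDr bf) addrAC addrK subrr.
- by rewrite FB !F1 (balancedA bf) subrr.
Qed.

Let Fpi s : tens_lift f (tens_pi s) = F s.
Proof.
rewrite /tens_lift -/F; apply/eqP; rewrite -subr_eq0 -FB; apply/eqP/F0.
by apply/tens_pi_eq; rewrite /tens_pi reprK.
Qed.

Lemma tens_liftE m n : tens_lift f (m \ot n) = f m n.
Proof. by rewrite /tens_mk Fpi F1. Qed.

Lemma tens_liftB : {morph tens_lift f : s t / s - t}.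
Proof.
move=> s t; rewrite -[s]reprK -[t]reprK -!/(tens_pi _) -tens_piB !Fpi.
exact: FB.
Qed.

Lemma tens_lift0 : tens_lift f 0 = 0.
Proof. by have := tens_liftB 0 0; rewrite !subrr. Qed.

Lemma tens_liftD : {morph tens_lift f : s t / s + t}.
Proof.
move=> s t; rewrite -{1}[t]opprK tens_liftB -[- t]sub0r tens_liftB.
by rewrite tens_lift0 sub0r opprK.
Qed.

End Lift.

Lemma tens_mk_balanced : balanced (fun m n => m \ot n).
Proof. by split; [apply: tens_mkDl|apply: tens_mkDr|apply: tens_mkA]. Qed.

Lemma tens_ext (V : zmodType) (f g : tens M N -> V) :
  f 0 = 0 -> g 0 = 0 ->
  {morph f : s t / s + t} -> {morph g : s t / s + t} ->
  (forall m n, f (m \ot n) = g (m \ot n)) -> f =1 g.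
Proof.
move=> f0 g0 fD gD fg t.
elim/tens_ind: t => [|m n t IH]; first by rewrite f0 g0.
by rewrite fD gD IH fg.
Qed.

End TensorTheory.

Section TensorScalars.
Context {k : comPzRingType} {A : kalg k} (M : lmodType A^c) (N : lmodType A).
Implicit Types (c : k) (t : tens M N).

Let ind := @tens_ind A M N.

(* Every one-sided A-module is a k-module through [kin A]; so is a tensor
   product over A. *)
Definition tens_scale c t : tens M N :=
  tens_lift (fun m n => (m :* kin A c) \ot n) t.

Lemma tens_scale_balanced c :
  balanced (fun (m : M) (n : N) => (m :* kin A c) \ot n).
Proof.
split=> [m m' n|m n n'|m a n]; rewrite ?rscaleDl ?tens_mkDl ?tens_mkDr //.
by rewrite -rscaleM -kinC rscaleM tens_mkA.
Qed.

Lemma tens_scaleE c m n : tens_scale c (m \ot n) = (m :* kin A c) \ot n.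
Proof. exact: (tens_liftE (tens_scale_balanced c)). Qed.

Lemma tens_scale0 c : tens_scale c 0 = 0.
Proof. exact: (tens_lift0 (tens_scale_balanced c)). Qed.

Lemma tens_scaleDr : right_distributive tens_scale +%R.
Proof. by move=> c; apply: (tens_liftD (tens_scale_balanced c)). Qed.

Lemma tens_scaleDl t : {morph tens_scale^~ t : c d / c + d}.
Proof.
move=> c d; elim/ind: t => [|m n t IH]; first by rewrite !tens_scale0 addr0.
rewrite !tens_scaleDr IH !tens_scaleE rmorphD rscaleDr tens_mkDl.
by rewrite addrACA.
Qed.

Lemma tens_scaleA c d t : tens_scale c (tens_scale d t) = tens_scale (c * d) t.
Proof.
elim/ind: t => [|m n t IH]; first by rewrite !tens_scale0.
by rewrite !tens_scaleDr IH !tens_scaleE rmorphM -rscaleM kinC.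
Qed.

Lemma tens_scale1 : left_id 1 tens_scale.
Proof.
move=> t; elim/ind: t => [|m n t IH]; first by rewrite !tens_scale0.
by rewrite !tens_scaleDr IH !tens_scaleE rmorph1 rscale1.
Qed.

HB.instance Definition _ := GRing.Zmodule_isLmodule.Build k (tens M N)
  tens_scaleA tens_scale1 tens_scaleDr tens_scaleDl.

Lemma tens_kscaleE c (m : M) (n : N) : c *: (m \ot n) = (m :* kin A c) \ot n.
Proof. exact: tens_scaleE. Qed.

End TensorScalars.

(* (A, B)-bimodules over k: the two actions of k agree. *)
Record bimod (k : comPzRingType) (A B : kalg k) := BiMod {
  bm_left :> lmodType A;
  bmr : bm_left -> B -> bm_left;
  bmrDl : forall p q b, bmr (p + q) b = bmr p b + bmr q b;
  bmrDr : forall p b c, bmr p (b + c) = bmr p b + bmr p c;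
  bmrM : forall p b c, bmr p (b * c) = bmr (bmr p b) c;
  bmr1 : forall p, bmr p 1 = p;
  bmrZ : forall a p b, bmr (a *: p) b = a *: bmr p b;
  bmr_k : forall c p, bmr p (kin B c) = kin A c *: p }.

Section Bimodules.
Context {k : comPzRingType} {A B : kalg k} (P : bimod A B).

Lemma bmr0l b : bmr (0 : P) b = 0.
Proof. by apply: (@addIr _ (bmr 0 b)); rewrite -bmrDl !add0r. Qed.

Lemma bmr0 (p : P) : bmr p 0 = 0.
Proof. by apply: (@addIr _ (bmr p 0)); rewrite -bmrDr !add0r. Qed.

(* An alias of P that carries its right action. *)
Definition bm_right : Type := P.

HB.instance Definition _ := GRing.Zmodule.on bm_right.

Definition bm_rscale (b : B^c) (p : bm_right) : bm_right := bmr (p : P) b.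

Lemma bm_rscaleA b c p : bm_rscale b (bm_rscale c p) = bm_rscale (b * c) p.
Proof. by rewrite /bm_rscale -bmrM. Qed.
Lemma bm_rscale1 : left_id 1 bm_rscale.
Proof. by move=> p; apply: bmr1. Qed.
Lemma bm_rscaleDr : right_distributive bm_rscale +%R.
Proof. by move=> b p q; apply: bmrDl. Qed.
Lemma bm_rscaleDl p : {morph bm_rscale^~ p : b c / b + c}.
Proof. by move=> b c; apply: bmrDr. Qed.

HB.instance Definition _ := GRing.Zmodule_isLmodule.Build B^c bm_right
  bm_rscaleA bm_rscale1 bm_rscaleDr bm_rscaleDl.

End Bimodules.

Record grbimod (k : comPzRingType) (G H : groupType) (A : galg k G)
    (B : galg k H) (X : rset G) (Y : rset H) := GrBiMod {
  gb_bimod :> bimod A B;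
  gb_comp : X * Y -> set gb_bimod;
  gb_sum : direct_sum gb_comp;
  gb_deg : forall g x y h a p b,
    gcomp A g a -> gb_comp (x, y) p -> gcomp B h b ->
    gb_comp (lact g x, ract y h) (bmr (a *: p) b) }.

Arguments gb_comp {k G H A B X Y} _ _ _.

Section GradedBimodules.
Context {k : comPzRingType} {G H : groupType} {A : galg k G} {B : galg k H}.
Context {X : rset G} {Y : rset H} (P : grbimod A B X Y).

Lemma gb_degl g x y a p :
  gcomp A g a -> gb_comp P (x, y) p -> gb_comp P (lact g x, y) (a *: p).
Proof.
by move=> ga xyp; have := gb_deg ga xyp (gcomp1 B); rewrite ract1 bmr1.
Qed.

Lemma gb_degr x y h p b :
  gb_comp P (x, y) p -> gcomp B h b -> gb_comp P (x, ract y h) (bmr p b).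
Proof.
move=> xyp hb; have := gb_deg (gcomp1 A) xyp hb.
by rewrite scale1r /lact invg1 ract1.
Qed.

(* [gb_row x] and [gb_col y] are the partial sums {}_x P and P_y. *)
Definition gb_row (x : X) : set P := isum (gb_comp P) [set i | i.1 = x].
Definition gb_col (y : Y) : set P := isum (gb_comp P) [set i | i.2 = y].

Lemma gb_rowZ x (b : B^c) (p : bm_right P) : gb_row x p -> gb_row x (b *: p).
Proof.
have [_ /(_ b) Bb _] := gcomp_sum B.
apply: (@isum_map _ _ (bm_right P) (bm_right P) _ _ _ _ ( *:%R b)) => [||[x' y]].
- exact: scaler0.
- exact: scalerDr.
move=> {}p /= -> xyp; elim: Bb => [|h c b' _ hc _ IH].
  by rewrite scale0r; apply: isum0.
rewrite scalerDl; apply: isumD IH; apply: (isum_elt (i := (x, ract y h))) => //.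
exact: gb_degr.
Qed.

Lemma gb_sumZ (J : set (X * Y)) (a : A) (p : P) :
  (forall g x y, J (x, y) -> J (lact g x, y)) ->
  isum (gb_comp P) J p -> isum (gb_comp P) J (a *: p).
Proof.
have [_ /(_ a) Aa _] := gcomp_sum A.
move=> JG; apply: (@isum_map _ _ P P _ _ _ _ ( *:%R a)) => [||[x y]].
- exact: scaler0.
- exact: scalerDr.
move=> {}p Jxy xyp; elim: Aa => [|g c a' _ gc _ IH].
  by rewrite scale0r; apply: isum0.
rewrite scalerDl; apply: isumD IH; apply: (isum_elt (i := (lact g x, y))).
  exact: JG.
exact: gb_degl.
Qed.

Lemma gb_colZ y (a : A) (p : P) : gb_col y p -> gb_col y (a *: p).
Proof. by apply: gb_sumZ. Qed.

Definition gb_row_mod (x : X) : submod (bm_right P) :=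
  @SubMod _ (bm_right P) (gb_row x) (isum0 _ _) (fun v w => @isumD _ _ _ _ v w)
    (@gb_rowZ x).

Definition gb_col_mod (y : Y) : submod P :=
  @SubMod _ P (gb_col y) (isum0 _ _) (fun v w => @isumD _ _ _ _ v w)
    (@gb_colZ y).

End GradedBimodules.

Arguments gb_row {k G H A B X Y} P _ _.
Arguments gb_col {k G H A B X Y} P _ _.

Record lincat (k : comPzRingType) := LinCat {
  lobj :> Type;
  lhom : lobj -> lobj -> lmodType k;
  lid : forall a, lhom a a;
  lcomp : forall a b c, lhom b c -> lhom a b -> lhom a c;
  lcomp1l : forall a b (f : lhom a b), lcomp (lid b) f = f;
  lcomp1r : forall a b (f : lhom a b), lcomp f (lid a) = f;
  lcompA : forall a b c d (h : lhom c d) (g : lhom b c) (f : lhom a b),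
    lcomp h (lcomp g f) = lcomp (lcomp h g) f;
  lcomp_linl : forall a b c z (g g' : lhom b c) (f : lhom a b),
    lcomp (z *: g + g') f = z *: lcomp g f + lcomp g' f;
  lcomp_linr : forall a b c z (g : lhom b c) (f f' : lhom a b),
    lcomp g (z *: f + f') = z *: lcomp g f + lcomp g f' }.

Notation "g \oc f" := (lcomp g f) (at level 50, left associativity).

Record linfunctor (k : comPzRingType) (C D : lincat k) := LinFunctor {
  fobj :> C -> D;
  fmap : forall a b : C, lhom a b -> lhom (fobj a) (fobj b);
  fmap_id : forall a, fmap (lid a) = lid (fobj a);
  fmap_comp : forall a b c (g : lhom b c) (f : lhom a b),
    fmap (g \oc f) = fmap g \oc fmap f;
  fmap_lin : forall a b z (f f' : lhom a b),
    fmap (z *: f + f') = z *: fmap f + fmap f' }.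

Arguments fmap {k C D} _ {a b} _.

Section Functors.
Context {k : comPzRingType} {C D : lincat k}.

Definition functor_iso (F F' : linfunctor C D) : Prop :=
  exists (u : forall a, lhom (F a) (F' a)) (v : forall a, lhom (F' a) (F a)),
  [/\ forall a b (f : lhom a b), u b \oc fmap F f = fmap F' f \oc u a,
      forall a, v a \oc u a = lid (F a)
    & forall a, u a \oc v a = lid (F' a)].

Definition left_adjoint (F : linfunctor C D) (U : linfunctor D C) : Prop :=
  exists (eta : forall a : C, lhom a (U (F a)))
         (eps : forall b : D, lhom (F (U b)) b),
  [/\ forall a a' (f : lhom a a'), eta a' \oc f = fmap U (fmap F f) \oc eta a,
      forall b b' (g : lhom b b'), eps b' \oc fmap F (fmap U g) = g \oc eps b,
      forall a, eps (F a) \oc fmap F (eta a) = lid (F a)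
    & forall b, fmap U (eps b) \oc eta (U b) = lid (U b)].

End Functors.

Definition frobenius_pair (k : comPzRingType) (C D : lincat k)
    (S : linfunctor C D) (T : linfunctor D C) : Prop :=
  left_adjoint T S /\ left_adjoint S T.

Record grmod (k : comPzRingType) (G : groupType) (A : galg k G) (X : rset G) :=
  GrMod {
    gm_mod :> lmodType A^c;
    gm_comp : X -> set gm_mod;
    gm_sum : direct_sum gm_comp;
    gm_deg : forall x g m a,
      gm_comp x m -> gcomp A g a -> gm_comp (ract x g) (m :* a) }.

Arguments gm_comp {k G A X} _ _ _.

#[local] Obligation Tactic := idtac.

Section GrHom.
Context {k : comPzRingType} {G : groupType} {A : galg k G} {X : rset G}.

Lemma gm_compk (M : grmod A X) x c m :
  gm_comp M x m -> gm_comp M x (m :* kin A c).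
Proof.
move=> xm; rewrite -[x]ract1 -[kin A c]mulr1; apply: gm_deg => //.
by apply: gcompZ; apply: gcomp1.
Qed.

Record grhom (M N : grmod A X) := GrHom {
  grhom_fun :> M -> N;
  grhomD : forall m m', grhom_fun (m + m') = grhom_fun m + grhom_fun m';
  grhomZ : forall m a, grhom_fun (m :* a) = grhom_fun m :* a;
  grhom_deg : forall x m, gm_comp M x m -> gm_comp N x (grhom_fun m) }.

Section HomModule.
Context {M N : grmod A X}.
Implicit Types (f g : grhom M N) (c : k).

Lemma grhom_eq f g : f =1 g -> f = g.
Proof.
case: f g => [f fD fZ fd] [g gD gZ gd] /= /funext E; case: _ / E in gD gZ gd *.
by congr GrHom; apply: Prop_irrelevance.
Qed.

HB.instance Definition _ := gen_eqMixin (grhom M N).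
HB.instance Definition _ := gen_choiceMixin (grhom M N).

Program Definition grhom_zero : grhom M N := @GrHom M N (fun=> 0) _ _ _.
Next Obligation. by move=> m m' /=; rewrite addr0. Qed.
Next Obligation. by move=> m a /=; rewrite rscale0l. Qed.
Next Obligation. by move=> x m _; have [/(_ x)[]] := gm_sum N. Qed.

Program Definition grhom_opp f : grhom M N := @GrHom M N (fun m => - f m) _ _ _.
Next Obligation. by move=> f m m' /=; rewrite grhomD opprD. Qed.
Next Obligation. by move=> f m a /=; rewrite grhomZ rscaleNl. Qed.
Next Obligation.
move=> f x m xm; have [/(_ x) sN _ _] := gm_sum N.
by apply: subgroupN (grhom_deg f xm).
Qed.

Program Definition grhom_add f g : grhom M N :=
  @GrHom M N (fun m => f m + g m) _ _ _.
Next Obligation. by move=> f g m m' /=; rewrite !grhomD addrACA. Qed.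
Next Obligation. by move=> f g m a /=; rewrite !grhomZ rscaleDl. Qed.
Next Obligation.
move=> f g x m xm; have [/(_ x) sN _ _] := gm_sum N.
by apply: subgroupD (grhom_deg f xm) (grhom_deg g xm).
Qed.

Program Definition grhom_scale c f : grhom M N :=
  @GrHom M N (fun m => f m :* kin A c) _ _ _.
Next Obligation. by move=> c f m m' /=; rewrite grhomD rscaleDl. Qed.
Next Obligation. by move=> c f m a /=; rewrite grhomZ -!rscaleM kinC. Qed.
Next Obligation. by move=> c f x m xm; apply: gm_compk (grhom_deg f xm). Qed.

Fact grhom_addA : associative grhom_add.
Proof. by move=> f g h; apply: grhom_eq => m /=; rewrite addrA. Qed.
Fact grhom_addC : commutative grhom_add.
Proof. by move=> f g; apply: grhom_eq => m /=; rewrite addrC. Qed.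
Fact grhom_add0 : left_id grhom_zero grhom_add.
Proof. by move=> f; apply: grhom_eq => m /=; rewrite add0r. Qed.
Fact grhom_addN : left_inverse grhom_zero grhom_opp grhom_add.
Proof. by move=> f; apply: grhom_eq => m /=; rewrite addNr. Qed.

HB.instance Definition _ := GRing.isZmodule.Build (grhom M N)
  grhom_addA grhom_addC grhom_add0 grhom_addN.

Fact grhom_scaleA c d f : grhom_scale c (grhom_scale d f) = grhom_scale (c * d) f.
Proof. by apply: grhom_eq => m /=; rewrite -rscaleM -rmorphM mulrC. Qed.
Fact grhom_scale1 : left_id 1 grhom_scale.
Proof. by move=> f; apply: grhom_eq => m /=; rewrite rmorph1 rscale1. Qed.
Fact grhom_scaleDr : right_distributive grhom_scale +%R.
Proof. by move=> c f g; apply: grhom_eq => m /=; rewrite rscaleDl. Qed.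
Fact grhom_scaleDl f : {morph grhom_scale^~ f : c d / c + d}.
Proof. by move=> c d; apply: grhom_eq => m /=; rewrite rmorphD rscaleDr. Qed.

HB.instance Definition _ := GRing.Zmodule_isLmodule.Build k (grhom M N)
  grhom_scaleA grhom_scale1 grhom_scaleDr grhom_scaleDl.

End HomModule.

Lemma grhom0 (M N : grmod A X) (f : grhom M N) : f 0 = 0.
Proof. by apply: (@addIr _ (f 0)); rewrite -grhomD !add0r. Qed.

Definition grhom_id (M : grmod A X) : grhom M M :=
  @GrHom M M id (fun _ _ => erefl) (fun _ _ => erefl) (fun _ _ => id).

Program Definition grhom_comp (M N Q : grmod A X) (g : grhom N Q) (f : grhom M N) :
  grhom M Q := @GrHom M Q (g \o f) _ _ _.
Next Obligation. by move=> M N Q g f m m' /=; rewrite !grhomD. Qed.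
Next Obligation. by move=> M N Q g f m a /=; rewrite !grhomZ. Qed.
Next Obligation. by move=> M N Q g f x m xm; apply/grhom_deg/grhom_deg. Qed.

End GrHom.

Program Definition gr (k : comPzRingType) (G : groupType) (A : galg k G)
    (X : rset G) : lincat k :=
  @LinCat k (grmod A X) (fun M N => grhom M N) (@grhom_id k G A X)
    (@grhom_comp k G A X) _ _ _ _ _.
Next Obligation. by move=> *; apply: grhom_eq. Qed.
Next Obligation. by move=> *; apply: grhom_eq. Qed.
Next Obligation. by move=> *; apply: grhom_eq. Qed.
Next Obligation. by move=> *; apply: grhom_eq. Qed.
Next Obligation.
by move=> *; apply: grhom_eq => m /=; rewrite grhomD grhomZ.
Qed.

(* For a left A-module N with X-components D, the k-submodule M \hat\ot_A N
   of M \ot_A N. *)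
Definition ctens_set (k : comPzRingType) (G : groupType) (A : galg k G)
    (X : rset G) (M : grmod A X) (N : lmodType A) (D : X -> set N) :
    set (tens M N) :=
  kspan [set t | exists x m n, [/\ gm_comp M x m, D x n & t = m \ot n]].

Section RightTensor.
Context {k : comPzRingType} {A B : kalg k} (M : lmodType A^c) (P : bimod A B).
Implicit Types (b : B) (t : tens M P).

Let ind := @tens_ind A M P.

(* An alias of M \ot_A P that carries the right action of B, [tens M P]
   itself being a k-module. *)
Definition rtens : Type := tens M P.

HB.instance Definition _ := GRing.Zmodule.on rtens.

Definition rtens_scale (b : B^c) : rtens -> rtens :=
  tens_lift (fun (m : M) (p : P) => m \ot bmr p b).

Lemma rtens_scale_balanced b : balanced (fun (m : M) (p : P) => m \ot bmr p b).
Proof.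
split=> [m m' p|m p q|m a p]; rewrite ?tens_mkDl ?bmrDl ?tens_mkDr //.
by rewrite tens_mkA bmrZ.
Qed.

Lemma rtens_scaleE b m (p : P) : rtens_scale b (m \ot p) = m \ot bmr p b.
Proof. exact: (tens_liftE (rtens_scale_balanced b)). Qed.

Lemma rtens_scale0 b : rtens_scale b 0 = 0.
Proof. exact: (tens_lift0 (rtens_scale_balanced b)). Qed.

Lemma rtens_scaleDr : right_distributive rtens_scale +%R.
Proof. by move=> b; apply: (tens_liftD (rtens_scale_balanced b)). Qed.

Lemma rtens_scaleDl t : {morph rtens_scale^~ t : b c / b + c}.
Proof.
move=> b c; elim/ind: t => [|m p t IH]; first by rewrite !rtens_scale0 addr0.
by rewrite !rtens_scaleDr IH !rtens_scaleE bmrDr tens_mkDr addrACA.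
Qed.

Lemma rtens_scaleA (b c : B^c) t :
  rtens_scale b (rtens_scale c t) = rtens_scale (b * c) t.
Proof.
elim/ind: t => [|m p t IH]; first by rewrite !rtens_scale0.
by rewrite !rtens_scaleDr IH !rtens_scaleE -(bmrM p).
Qed.

Lemma rtens_scale1 : left_id 1 rtens_scale.
Proof.
move=> t; elim/ind: t => [|m p t IH]; first by rewrite !rtens_scale0.
by rewrite !rtens_scaleDr IH !rtens_scaleE bmr1.
Qed.

HB.instance Definition _ := GRing.Zmodule_isLmodule.Build B^c rtens
  rtens_scaleA rtens_scale1 rtens_scaleDr rtens_scaleDl.

Lemma rtens_rscaleE (b : B) m (p : P) : (m \ot p : rtens) :* b = m \ot bmr p b.
Proof. exact: rtens_scaleE. Qed.

Lemma rtens_rscale_k c t : (t : rtens) :* kin B c = c *: t :> tens M P.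
Proof.
elim/ind: t => [|m p t IH]; first by rewrite rscale0l scaler0.
rewrite [LHS]rscaleDl scalerDr -IH; congr (_ + _).
by rewrite [LHS]rtens_rscaleE bmr_k -tens_mkA tens_kscaleE.
Qed.

Lemma rtens_kscale c t (b : B) :
  ((c *: t : tens M P) : rtens) :* b = c *: ((t : rtens) :* b : tens M P).
Proof.
elim/ind: t => [|m p t IH]; first by rewrite scaler0 rscale0l scaler0.
rewrite scalerDr [LHS]rscaleDl [(_ + t : rtens) :* b]rscaleDl scalerDr IH.
congr (_ + _); rewrite tens_kscaleE.
by rewrite [LHS]rtens_rscaleE rtens_rscaleE tens_kscaleE.
Qed.

End RightTensor.

Section CompletedTensor.
Context {k : comPzRingType} {G H : groupType} {A : galg k G} {B : galg k H}.
Context {X : rset G} {Y : rset H} (P : grbimod A B X Y).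

Section Objects.
Variable M : grmod A X.

Lemma ctens_rscale (D D' : X -> set P) (b : B) :
  (forall x p, D x p -> D' x (bmr p b)) ->
  forall t : rtens M P, ctens_set D t -> ctens_set D' (t :* b).
Proof.
move=> DD' t; elim=> [|c e u [x [m [p [xm xp ->]]]] _ IH].
  by rewrite rscale0l; apply: kspan0.
rewrite [X in ctens_set _ X]rscaleDl rtens_kscale rtens_rscaleE.
by apply: kspanC IH; exists x, m, (bmr p b); split=> //; apply: DD'.
Qed.

Lemma ctens_setD (D : X -> set P) (t u : rtens M P) :
  ctens_set D t -> ctens_set D u -> ctens_set D (t + u).
Proof. exact: (@kspanD _ (tens M P)). Qed.

Definition ctens_mod : submod (rtens M P) :=
  @SubMod _ (rtens M P) (ctens_set (gb_row P))
    (kspan0 _) (@ctens_setD _)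
    (fun b => ctens_rscale (fun x p => @gb_rowZ _ _ _ _ _ _ _ P x b p)).

(* The component M \hat\ot_A P_y, identified with its image in M \ot_A P:
   the component of degree x of the left module P_y is P_(x, y). *)
Definition ctens_comp (y : Y) : set (submod_of ctens_mod) :=
  fun t => ctens_set (N := P) (fun x => gb_comp P (x, y)) (submod_val t : rtens M P).

Lemma ctens_comp_subgroup y : subgroup (ctens_comp y).
Proof.
split=> [|t u]; first exact: kspan0.
move=> Ht Hu; apply: (@kspanD _ (tens M P)) => //.
rewrite -[X in kspan _ X](@scaleN1r _ (tens M P)).
exact: (@kspanZ _ (tens M P)).
Qed.

Lemma ctens_comp_total t : isum ctens_comp setT t.
Proof.
suff [u [/val_inj <- //]] : exists u : submod_of ctens_mod,
  submod_val u = submod_val t /\ isum ctens_comp setT u.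
have : ctens_set (gb_row P) (submod_val t : rtens M P) := submod_valP t.
elim=> [|c _ u [x [m [p [xm xp ->]]]] _ [v [<- Hv]]].
  by exists 0; split=> //; apply: isum0.
suff [w [<- Hw]] : exists w : submod_of ctens_mod,
    submod_val w = c *: (m \ot p) :> tens M P /\ isum ctens_comp setT w.
  by exists (w + v); split=> //; apply: isumD.
rewrite tens_kscaleE; have {}xm := gm_compk c xm; set n := m :* _ in xm *.
elim: xp => [|[z y] q r /= -> xyq _ [w [Ew Hw]]].
  by exists 0; split; [rewrite tens_mk0r|apply: isum0].
have Hq (D : X -> set P) : D x q -> ctens_set D (n \ot q).
  by move=> Dq; apply: kspan_elt; exists x, n, q.
have nq : ctens_mod (n \ot q) by apply/Hq/(isum_elt (i := (x, y))).
exists (submod_mk nq + w); rewrite tens_mkDr -Ew; split=> //.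
by apply: isumD Hw; apply: (isum_elt (i := y)) => //; apply: Hq.
Qed.

(* id \ot pi_y, for pi_y the projection of P onto P_y. *)
Let proj (y : Y) : tens M P -> tens M P :=
  tens_lift (fun m p => m \ot dproj (gb_comp P) [set i | i.2 = y] p).

Let proj_balanced y :
  balanced (fun (m : M) p => m \ot dproj (gb_comp P) [set i | i.2 = y] p).
Proof.
split=> [m m' p|m p q|m a p].
- by rewrite tens_mkDl.
- by rewrite (dprojD (gb_sum P)) tens_mkDr.
rewrite tens_mkA; congr (_ \ot _); apply/esym/(dproj_eq (gb_sum P)).
  by apply: gb_sumZ (dprojP (gb_sum P) _ p).1.
by rewrite -scalerBr; apply: gb_sumZ (dprojP (gb_sum P) _ p).2.
Qed.

Let proj_comp y z t : ctens_comp z t ->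
  proj y (submod_val t) = if z == y then submod_val t else 0.
Proof.
rewrite /ctens_comp; move: (submod_val t) => u.
elim=> [|c _ v [x [m [p [xm xzp ->]]]] _ IH].
  by rewrite /proj (tens_lift0 (proj_balanced y)) if_same.
rewrite /proj (tens_liftD (proj_balanced y)) -/(proj y v) IH.
rewrite tens_kscaleE (tens_liftE (proj_balanced y)).
case: eqP => [zy|zy].
  rewrite (dproj_id (gb_sum P)) //.
  exact: (isum_elt (i := (x, z))).
rewrite (dproj_0 (gb_sum P)) ?tens_mk0r ?addr0 //.
exact: (isum_elt (i := (x, z))).
Qed.

Lemma ctens_sum : direct_sum ctens_comp.
Proof.
split=> [y|t|y t ty Ht]; [exact: ctens_comp_subgroup|exact: ctens_comp_total|].
apply: val_inj; rewrite -[LHS]/(submod_val t).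
have := proj_comp y ty; rewrite eqxx => <-.
elim: Ht => [|z c u /= /eqP zy zc _ IH].
  exact: (tens_lift0 (proj_balanced y)).
rewrite /proj (tens_liftD (proj_balanced y)) -!/(proj y _) IH.
by rewrite (proj_comp y zc) (negPf zy) addr0.
Qed.

Lemma ctens_deg y h t b : ctens_comp y t -> gcomp B h b ->
  ctens_comp (ract y h) (t :* b).
Proof.
move=> yt hb; apply: ctens_rscale yt => x p xyp; exact: gb_degr.
Qed.

Definition ctens : grmod B Y := GrMod ctens_sum ctens_deg.

End Objects.

Section Morphisms.
Context {M N : grmod A X} (f : grhom M N).

Definition tens_map : tens M P -> tens N P := tens_lift (fun m p => f m \ot p).

Lemma tens_map_balanced : balanced (fun (m : M) (p : P) => f m \ot p).
Proof.
split=> [m m' p|m p q|m a p]; rewrite ?grhomD ?tens_mkDl ?tens_mkDr //.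
by rewrite grhomZ tens_mkA.
Qed.

Lemma tens_mapE m p : tens_map (m \ot p) = f m \ot p.
Proof. exact: (tens_liftE tens_map_balanced). Qed.

Lemma tens_map0 : tens_map 0 = 0.
Proof. exact: (tens_lift0 tens_map_balanced). Qed.

Lemma tens_mapD : {morph tens_map : t u / t + u}.
Proof. exact: (tens_liftD tens_map_balanced). Qed.

Lemma tens_map_rscale (t : rtens M P) (b : B) :
  tens_map (t :* b) = (tens_map t : rtens N P) :* b.
Proof.
elim/(@tens_ind A M P): t => [|m p t IH].
  by rewrite rscale0l tens_map0 rscale0l.
have -> : tens_map ((m \ot p + t : rtens M P) :* b) =
    tens_map (m \ot bmr p b) + (tens_map t : rtens N P) :* b.
  rewrite -IH -tens_mapD -rtens_rscaleE; congr tens_map.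
  exact: (@rscaleDl _ (rtens M P)).
rewrite tens_mapD !tens_mapE [RHS](@rscaleDl _ (rtens N P)).
by rewrite rtens_rscaleE.
Qed.

Lemma tens_map_ctens (D : X -> set P) t :
  ctens_set D t -> ctens_set D (tens_map t).
Proof.
elim=> [|c _ u [x [m [p [xm xp ->]]]] _ IH]; first by rewrite tens_map0; apply: kspan0.
rewrite tens_mapD tens_kscaleE tens_mapE grhomZ -tens_kscaleE.
by apply: kspanC IH; exists x, (f m), p; split=> //; apply: grhom_deg.
Qed.

Definition ctens_map_fun (t : ctens M) : ctens N :=
  submod_mk (U := ctens_mod N) (tens_map_ctens (submod_valP t)).

Program Definition ctens_map : grhom (ctens M) (ctens N) :=
  @GrHom _ _ _ _ (ctens M) (ctens N) ctens_map_fun _ _ _.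
Next Obligation. by move=> t u; apply: val_inj; apply: tens_mapD. Qed.
Next Obligation. by move=> t b; apply: val_inj; apply: tens_map_rscale. Qed.
Next Obligation. by move=> y t; apply: tens_map_ctens. Qed.

End Morphisms.

Program Definition ctens_functor : linfunctor (gr A X) (gr B Y) :=
  @LinFunctor k (gr A X) (gr B Y) ctens (@ctens_map) _ _ _.
Next Obligation.
move=> M; apply: grhom_eq => t; apply: val_inj => /=.
apply: (tens_ext (g := id)) (submod_val t) => //.
- exact: tens_map0.
- exact: tens_mapD.
- by move=> m p; rewrite tens_mapE.
Qed.
Next Obligation.
move=> M N Q g f; apply: grhom_eq => t; apply: val_inj => /=.
apply: (tens_ext (g := tens_map g \o tens_map f)) (submod_val t) => /=.
- exact: tens_map0.
- by rewrite !tens_map0.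
- exact: tens_mapD.
- by move=> s u /=; rewrite !tens_mapD.
- by move=> m p; rewrite !tens_mapE.
Qed.
Next Obligation.
move=> M N c f g; apply: grhom_eq => t; apply: val_inj => /=.
rewrite [X in _ = X + _](_ : _ = c *: tens_map f (submod_val t) :> tens N P);
  last exact: (rtens_rscale_k (M := N) c (tens_map f (submod_val t))).
apply: (tens_ext (g := fun u => c *: tens_map f u + tens_map g u)) => /=.
- exact: tens_map0.
- by rewrite !tens_map0 scaler0 addr0.
- exact: tens_mapD.
- by move=> u v /=; rewrite !tens_mapD scalerDr addrACA.
- by move=> m p; rewrite !tens_mapE tens_kscaleE tens_mkDl.
Qed.

End CompletedTensor.

Section GradedDual.
Context {k : comPzRingType} {G H : groupType} {A : galg k G} {B : galg k H}.
Context {X : rset G} {Y : rset H} (P : grbimod A B X Y).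

(* H({}_A P, A). *)
Record gdual := GDual {
  gdual_fun :> P -> A;
  gdualD : forall p q, gdual_fun (p + q) = gdual_fun p + gdual_fun q;
  gdualZ : forall a p, gdual_fun (a *: p) = a * gdual_fun p;
  gdual_fin :
    finite_set [set y | ~ forall p, gb_col P y p -> gdual_fun p = 0] }.

Implicit Types (f : gdual) (a : A) (b : B).

Lemma gdual_eq f f' : f =1 f' -> f = f'.
Proof.
case: f f' => [f fD fZ ff] [g gD gZ gf] /= /funext E; case: _ / E in gD gZ gf *.
by congr GDual; apply: Prop_irrelevance.
Qed.

Lemma gdual0 f : f 0 = 0.
Proof. by apply: (@addIr _ (f 0)); rewrite -gdualD !add0r. Qed.

HB.instance Definition _ := gen_eqMixin gdual.
HB.instance Definition _ := gen_choiceMixin gdual.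

Program Definition gdual_zero : gdual := @GDual (fun=> 0) _ _ _.
Next Obligation. by move=> p q /=; rewrite addr0. Qed.
Next Obligation. by move=> a p /=; rewrite mulr0. Qed.
Next Obligation.
by apply: (sub_finite_set _ (finite_set0 Y)) => y /= Hy; apply: Hy.
Qed.

Program Definition gdual_opp f : gdual := @GDual (fun p => - f p) _ _ _.
Next Obligation. by move=> f p q /=; rewrite gdualD opprD. Qed.
Next Obligation. by move=> f a p /=; rewrite gdualZ mulrN. Qed.
Next Obligation.
move=> f; apply: sub_finite_set (gdual_fin f) => y /= Hy Hf; apply: Hy => p yp.
by rewrite Hf ?oppr0.
Qed.

Program Definition gdual_add f f' : gdual := @GDual (fun p => f p + f' p) _ _ _.
Next Obligation. by move=> f f' p q /=; rewrite !gdualD addrACA. Qed.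
Next Obligation. by move=> f f' a p /=; rewrite !gdualZ mulrDr. Qed.
Next Obligation.
move=> f f'; have := conj (gdual_fin f) (gdual_fin f'); rewrite -finite_setU.
apply: sub_finite_set => y /= Hy; apply: contrapT => /not_orP[/contrapT Hf].
by move=> /contrapT Hf'; apply: Hy => p yp; rewrite Hf ?Hf' ?addr0.
Qed.

Program Definition gdual_lscale b f : gdual :=
  @GDual (fun p => f (bmr p b)) _ _ _.
Next Obligation. by move=> b f p q /=; rewrite bmrDl gdualD. Qed.
Next Obligation. by move=> b f a p /=; rewrite bmrZ gdualZ. Qed.
Next Obligation.
move=> b f; have [_ /(_ b) Bb _] := gcomp_sum B.
elim: Bb => [|h c b' _ hc _ IH].
  apply: (sub_finite_set _ (finite_set0 Y)) => y /= Hy; apply: Hy => p _.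
  by rewrite bmr0 gdual0.
have Fc : finite_set [set y | ~ forall p, gb_col P y p -> f (bmr p c) = 0].
  have := finite_image (fun z => ract z h^-1%g) (gdual_fin f).
  apply: sub_finite_set => y /= Hy; exists (ract y h).
    move=> Hf; apply: Hy => p yp; apply: Hf.
    apply: (@isum_map _ _ P P _ _ _ _ (fun q => bmr q c)) yp.
    - exact: bmr0l.
    - by move=> q r; apply: bmrDl.
    move=> [x z] q /= -> xyq; apply: (isum_elt (i := (x, ract y h))) => //.
    exact: gb_degr.
  by rewrite -ractM mulgV ract1.
have := conj Fc IH; rewrite -finite_setU.
apply: sub_finite_set => y /= Hy; apply: contrapT => /not_orP[/contrapT Hf].
by move=> /contrapT Hf'; apply: Hy => p yp; rewrite bmrDr gdualD Hf ?Hf' ?addr0.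
Qed.

Program Definition gdual_rscale f a : gdual := @GDual (fun p => f p * a) _ _ _.
Next Obligation. by move=> f a p q /=; rewrite gdualD mulrDl. Qed.
Next Obligation. by move=> f a a' p /=; rewrite gdualZ mulrA. Qed.
Next Obligation.
move=> f a; apply: sub_finite_set (gdual_fin f) => y /= Hy Hf; apply: Hy => p yp.
by rewrite Hf ?mul0r.
Qed.

Fact gdual_addA : associative gdual_add.
Proof. by move=> f g h; apply: gdual_eq => p /=; rewrite addrA. Qed.
Fact gdual_addC : commutative gdual_add.
Proof. by move=> f g; apply: gdual_eq => p /=; rewrite addrC. Qed.
Fact gdual_add0 : left_id gdual_zero gdual_add.
Proof. by move=> f; apply: gdual_eq => p /=; rewrite add0r. Qed.
Fact gdual_addN : left_inverse gdual_zero gdual_opp gdual_add.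
Proof. by move=> f; apply: gdual_eq => p /=; rewrite addNr. Qed.

HB.instance Definition _ := GRing.isZmodule.Build gdual
  gdual_addA gdual_addC gdual_add0 gdual_addN.

Fact gdual_lscaleA b c f :
  gdual_lscale b (gdual_lscale c f) = gdual_lscale (b * c) f.
Proof. by apply: gdual_eq => p /=; rewrite bmrM. Qed.
Fact gdual_lscale1 : left_id 1 gdual_lscale.
Proof. by move=> f; apply: gdual_eq => p /=; rewrite bmr1. Qed.
Fact gdual_lscaleDr : right_distributive gdual_lscale +%R.
Proof. by move=> b f g; apply: gdual_eq => p. Qed.
Fact gdual_lscaleDl f : {morph gdual_lscale^~ f : b c / b + c}.
Proof. by move=> b c; apply: gdual_eq => p /=; rewrite bmrDr gdualD. Qed.

HB.instance Definition _ := GRing.Zmodule_isLmodule.Build B gdual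
  gdual_lscaleA gdual_lscale1 gdual_lscaleDr gdual_lscaleDl.

Program Definition gdual_bimod : bimod B A := @BiMod k B A gdual gdual_rscale _ _ _ _ _ _.
Next Obligation. by move=> f g a; apply: gdual_eq => p /=; rewrite mulrDl. Qed.
Next Obligation. by move=> f a a'; apply: gdual_eq => p /=; rewrite mulrDr. Qed.
Next Obligation. by move=> f a a'; apply: gdual_eq => p /=; rewrite mulrA. Qed.
Next Obligation. by move=> f; apply: gdual_eq => p /=; rewrite mulr1. Qed.
Next Obligation. by move=> b f a; apply: gdual_eq. Qed.
Next Obligation.
by move=> c f; apply: gdual_eq => p /=; rewrite bmr_k gdualZ kinC.
Qed.

(* The index (y, x) of a component lists the degree for the left B-action first. *)
Definition gdual_comp (i : Y * X) : set gdual_bimod := fun f : gdual =>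
  (forall y p, y <> i.1 -> gb_col P y p -> f p = 0) /\
  (forall x p, gb_row P x p -> isum (gcomp A) [set g | ract x g = i.2] (f p)).

End GradedDual.

Arguments gdual_comp {k G H A B X Y} P _ _.

(* The families C and D need not be assumed to be gradings: [gdual_comp P] is
   one as soon as every P_y is finitely generated. *)
Definition graded_iso (k : comPzRingType) (A B : kalg k) (I : Type)
    (P : bimod A B) (C : I -> set P) (Q : bimod A B) (D : I -> set Q) : Prop :=
  exists u : P -> Q,
  [/\ bijective u, {morph u : p q / p + q},
      forall a p, u (a *: p) = a *: u p,
      forall p b, u (bmr p b) = bmr (u p) b
    & forall i p, C i p <-> D i (u p)].

(* Main.v *)
Require Import Defs.
From HB Require Import structures.
From mathcomp Require Import all_boot all_algebra.
From mathcomp Require Import boolp classical_sets functions cardinality fsbigop.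

(* A graded A-module W is generated by the morphisms A(x) -> W, where A(x) is A
   with its unit in degree x, so a functor S has a candidate bimodule
   M = (+)_x S(A(x)) and a natural map from W \hat\ot_A M to S(W).  If S is a
   left adjoint this map is onto.  If moreover T is left adjoint to S, with unit
   eta and counit eps, then N = (+)_y T(A'(y)) pairs with M by
   (m, n) |-> eps (T(m^) n) in A, where m^ is the morphism determined by m.
   Writing eta (1_y) = sum_i w_i \ot p_i in S(T(A'(y))), the triangle identities
   say that (p_i) and (w_i) are dual bases of M_y and {}_y N; this gives
   projectivity, the isomorphism of N with the graded dual of M, and the
   injectivity of the natural map.  Exchanging S and T gives the other half.
   Conversely, a finitely generated projective P_y with graded dual Q has
   homogeneous dual bases (p_i), (q_i), and v |-> sum_i v \ot q_i \ot p_i and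
   w \ot p \ot q |-> w <p, q> are the unit and the counit of an adjunction
   between - \hat\ot Q and - \hat\ot P. *)

Set Implicit Arguments.
Unset Strict Implicit.
Unset Printing Implicit Defensive.

Import GRing.Theory.
Local Open Scope classical_set_scope.
Local Open Scope ring_scope.

(** * Additive maps, sums of finitely supported families, homogeneous components *)

Lemma morphD0 (V W : zmodType) (f : V -> W) : {morph f : x y / x + y} -> f 0 = 0.
Proof. by move=> fD; apply: (@addIr _ (f 0)); rewrite -fD !add0r. Qed.

Lemma morphDN (V W : zmodType) (f : V -> W) : {morph f : x y / x + y} ->
  {morph f : x / - x}.
Proof.
by move=> fD x; apply/eqP; rewrite -addr_eq0 -fD addNr (morphD0 fD).
Qed.

Lemma morphD_sum (V W : zmodType) (f : V -> W) (I : Type) (r : seq I) (E : I -> V) :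
  {morph f : x y / x + y} -> f (\sum_(i <- r) E i) = \sum_(i <- r) f (E i).
Proof. by move=> fD; apply: (big_morph f fD (morphD0 fD)). Qed.

Lemma isum_ind_in (I : Type) (V : zmodType) (C : I -> set V) (J : set I) (U : set V) :
  subgroup U -> (forall i, J i -> C i `<=` U) -> isum C J `<=` U.
Proof.
move=> sU CU v; elim=> [|i c u Ji Cc _ Uu]; first exact: sU.1.
by apply: subgroupD => //; apply: CU Cc.
Qed.

Section FiniteSums.
Context {I : choiceType}.

Definition fin_supp (V : zmodType) (F : I -> V) :=
  exists s : seq I, forall i, i \notin s -> F i = 0.

(** The value is 0 by convention when the support is infinite; hence the [fin_supp] hypotheses
    wherever additivity is claimed. *)
Definition fsum (V : zmodType) (F : I -> V) : V := \sum_(i \in [set: I]) F i.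

Lemma fsumE (V : zmodType) s (F : I -> V) :
  uniq s -> (forall i, i \notin s -> F i = 0) -> fsum F = \sum_(i <- s) F i.
Proof.
move=> us F0; rewrite /fsum (fsbigE s F us) // => [|i /= _ /F0 //].
by under eq_bigl do rewrite in_setT.
Qed.

Lemma fsum1 (V : zmodType) i (F : I -> V) :
  (forall j, j <> i -> F j = 0) -> fsum F = F i.
Proof.
move=> F0; rewrite (@fsumE _ [:: i]) ?big_seq1 // => j.
by rewrite inE => /eqP; apply: F0.
Qed.

Lemma fsum0 (V : zmodType) (F : I -> V) : (forall i, F i = 0) -> fsum F = 0.
Proof. by move=> F0; rewrite (@fsumE _ [::]) ?big_nil. Qed.

Lemma eq_fsum (V : zmodType) (F F' : I -> V) : F =1 F' -> fsum F = fsum F'.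
Proof. by move=> /funext ->. Qed.

Lemma fin_supp_uniq (V : zmodType) (F : I -> V) : fin_supp F ->
  exists2 s : seq I, uniq s & forall i, i \notin s -> F i = 0.
Proof.
by move=> [s F0]; exists (undup s) => [|i]; rewrite ?undup_uniq ?mem_undup //; apply: F0.
Qed.

Lemma fsumD (V : zmodType) (F F' : I -> V) : fin_supp F -> fin_supp F' ->
  fsum (fun i => F i + F' i) = fsum F + fsum F'.
Proof.
move=> [s F0] [s' F'0]; have us := undup_uniq (s ++ s').
have H i : i \notin undup (s ++ s') -> F i = 0 /\ F' i = 0.
  by rewrite mem_undup mem_cat negb_or => /andP[/F0 ? /F'0].
rewrite !(fsumE us) => [|i /H[]//|i /H[]//|i /H[-> ->]]; last by rewrite addr0.
exact: big_split.
Qed.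

Lemma fsum_morph (V W : zmodType) (f : V -> W) (F : I -> V) :
  {morph f : x y / x + y} -> fin_supp F -> f (fsum F) = fsum (fun i => f (F i)).
Proof.
move=> fD /fin_supp_uniq[s us F0].
rewrite (fsumE us F0) (fsumE us) ?morphD_sum // => i /F0 ->; exact: morphD0.
Qed.

End FiniteSums.


Definition dcomp (I : Type) (V : zmodType) (C : I -> set V) (i : I) (v : V) : V :=
  dproj C [set i] v.

Section Components.
Context {I : choiceType} {V : zmodType} {C : I -> set V} (dC : direct_sum C).

Lemma dcompD i : {morph dcomp C i : v w / v + w}.
Proof. exact: dprojD. Qed.

Lemma dcomp0 i : dcomp C i 0 = 0.
Proof. exact/morphD0/dcompD. Qed.

Lemma isum_set1 i v : isum C [set i] v -> C i v.
Proof.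
have [sC _ _] := dC.
by apply: (isum_ind_in (sC i)) => j /= -> u.
Qed.

Lemma dcomp_in i v : C i (dcomp C i v).
Proof. exact/isum_set1/(dprojP dC [set i] v).1. Qed.

Lemma dcomp_id i v : C i v -> dcomp C i v = v.
Proof. by move=> Cv; apply: (dproj_id dC); apply: (isum_elt (i := i)). Qed.

Lemma dcomp_ne i j v : C j v -> j <> i -> dcomp C i v = 0.
Proof. by move=> Cv ji; apply: (dproj_0 dC); apply: (isum_elt (i := j)). Qed.

Lemma direct_sum_ind (P : V -> Prop) :
  P 0 -> (forall i c v, C i c -> P v -> P (c + v)) -> forall v, P v.
Proof.
move=> P0 PD v; have [_ /(_ v) + _] := dC.
elim=> [|i c u _ Cc _]; [exact: P0|exact: PD Cc].
Qed.

Lemma direct_sum_ext (W : zmodType) (f g : V -> W) :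
  {morph f : x y / x + y} -> {morph g : x y / x + y} ->
  (forall i c, C i c -> f c = g c) -> f =1 g.
Proof.
move=> fD gD fg; apply: direct_sum_ind => [|i c v Cc IH].
  by rewrite (morphD0 fD) (morphD0 gD).
by rewrite fD gD IH (fg i).
Qed.

Lemma dcomp_supp v : fin_supp (fun i => dcomp C i v).
Proof.
elim/direct_sum_ind: v => [|i c v Cc [s Hs]].
  by exists [::] => i _; rewrite dcomp0.
exists (i :: s) => j; rewrite inE negb_or => /andP[/eqP ji /Hs js].
by rewrite dcompD js addr0 (dcomp_ne Cc) // => ij; apply: ji.
Qed.

Lemma dcomp_sum v : fsum (fun i => dcomp C i v) = v.
Proof.
elim/direct_sum_ind: v => [|i c v Cc IH].
  by apply: fsum0 => i; rewrite dcomp0.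
under eq_fsum do rewrite dcompD.
rewrite fsumD ?IH; try exact: dcomp_supp.
by rewrite (@fsum1 _ _ i) ?dcomp_id // => j ji; rewrite (dcomp_ne Cc) // => /esym.
Qed.

Lemma dcomp_inj v w : (forall i, dcomp C i v = dcomp C i w) -> v = w.
Proof. by move=> /funext E; rewrite -[v]dcomp_sum -[w]dcomp_sum E. Qed.

(** From right to left, [v] is the finite sum of its components, and those with index outside [J]
    drop out. *)
Lemma isumP J v : isum C J v <-> forall i, ~ J i -> dcomp C i v = 0.
Proof.
split=> [Hv i nJi|Hv].
  by apply: (dproj_0 dC); apply: isumS Hv => j Jj /= ji; apply: nJi; rewrite -ji.
rewrite -[v]dcomp_sum; have [s us Hs] := fin_supp_uniq (dcomp_supp v).
rewrite (fsumE us Hs); elim/big_ind: _ => [|x y|i _]; first exact: isum0.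
  exact: isumD.
have [Ji|/Hv ->] := pselect (J i); last exact: isum0.
exact: (isum_elt Ji (dcomp_in i v)).
Qed.

Lemma comp_subgroup i : subgroup (C i).
Proof. by case: dC. Qed.

Lemma comp_sum i (T : Type) (r : seq T) (E : T -> V) :
  (forall t, C i (E t)) -> C i (\sum_(t <- r) E t).
Proof.
move=> CE; elim/big_ind: _ => [|x y|//]; first exact: (comp_subgroup i).1.
exact: subgroupD (comp_subgroup i).
Qed.

Lemma compP i v : C i v <-> forall j, j <> i -> dcomp C j v = 0.
Proof.
split=> [Cv j ji|Hv]; first by apply: dcomp_ne Cv _ => /esym.
by apply: isum_set1; apply/isumP => j; apply: Hv.
Qed.

Lemma dcomp_isum (J : set I) i v : J i -> isum C (~` J) v -> dcomp C i v = 0.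
Proof. by move=> Ji /isumP; apply; apply. Qed.

(** Distinct fibres of [phi] are disjoint, so [isum_disj] gives independence. This provides the rows
    and columns of a bimodule and the shifted gradings of A. *)
Lemma direct_sum_regroup (K : Type) (phi : I -> K) :
  direct_sum (fun x => isum C [set i | phi i = x]).
Proof.
have [sC totC _] := dC; split=> [x|v|x v xv Hv].
- exact: isum_subgroup.
- elim/direct_sum_ind: v => [|i c v Cc]; first exact: isum0.
  by apply: (isumC (i := phi i)) => //; apply: isum_elt Cc.
apply: (isum_disj dC xv).
apply: (isum_ind_in _ _ Hv) => [|y /= yx u]; first exact: isum_subgroup.
by apply: isumS => i /= iy ix; apply: yx; rewrite -iy.
Qed.

End Components.

(** * Isomorphisms of functors and transport of adjunctions *)

Section FunctorIso.
Context {k : comPzRingType} {C D : lincat k}.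

Lemma functor_iso_sym (F F' : linfunctor C D) : functor_iso F F' -> functor_iso F' F.
Proof.
move=> [u [v [nat vu uv]]]; exists v, u; split=> // a b f.
rewrite -[LHS]lcomp1r -uv !lcompA; congr (_ \oc _).
by rewrite -[v b \oc _ \oc _]lcompA -nat !lcompA vu lcomp1l.
Qed.

(** Unit and counit are conjugated by the isomorphisms, and naturality carries these through the
    triangle identities. Condition (3) describes S and T only up to isomorphism, which is where the
    transport is used. *)
Lemma left_adjoint_iso (F F' : linfunctor C D) (U U' : linfunctor D C) :
  functor_iso F F' -> functor_iso U U' -> left_adjoint F U -> left_adjoint F' U'.
Proof.
move=> [u [v [unat vu uv]]] [p [r [pnat rp pr]]] [eta [eps [neta neps tF tU]]].
have vnat a b (f : lhom a b) : v b \oc fmap F' f = fmap F f \oc v a.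
  rewrite -[LHS]lcomp1r -uv !lcompA; congr (_ \oc _).
  by rewrite -[v b \oc _ \oc _]lcompA -unat !lcompA vu lcomp1l.
have rnat a b (f : lhom a b) : r b \oc fmap U' f = fmap U f \oc r a.
  rewrite -[LHS]lcomp1r -pr !lcompA; congr (_ \oc _).
  by rewrite -[r b \oc _ \oc _]lcompA -pnat !lcompA rp lcomp1l.
exists (fun a => p (F' a) \oc (fmap U (u a) \oc eta a)).
exists (fun b => eps b \oc (fmap F (r b) \oc v (U' b))).
split=> [a a' f|b b' g|a|b].
- rewrite -!lcompA neta [fmap U _ \oc (_ \oc _)]lcompA -fmap_comp unat.
  by rewrite fmap_comp !lcompA pnat.
- rewrite -!lcompA vnat [fmap F _ \oc (_ \oc _)]lcompA -fmap_comp rnat.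
  by rewrite fmap_comp !lcompA neps.
- rewrite -!lcompA vnat.
  rewrite [fmap F (r _) \oc _]lcompA -fmap_comp [r _ \oc _]lcompA rp lcomp1l.
  rewrite fmap_comp !lcompA neps -[u a \oc _ \oc _]lcompA tF.
  by rewrite lcomp1r uv.
rewrite !lcompA -pnat -[p _ \oc _ \oc _]lcompA -fmap_comp.
rewrite -[_ \oc u (U' b)]lcompA vu lcomp1r fmap_comp -!lcompA -neta.
by rewrite [fmap U _ \oc (_ \oc _)]lcompA tU lcomp1l pr.
Qed.

End FunctorIso.

(** * Graded modules *)

Section GradedModules.
Context {k : comPzRingType} {G : groupType} {A : galg k G} {X : rset G}.

Lemma rscale_isum (M : grmod A X) (J : set G) (x : X) (y : X) (m : M) (a : A) :
  (forall g, J g -> ract x g = y) ->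
  gm_comp M x m -> isum (gcomp A) J a -> gm_comp M y (m :* a).
Proof.
move=> Jxy xm; have sM := comp_subgroup (gm_sum M) y.
elim=> [|g c a' Jg gc _ IH]; first by rewrite rscale0; exact: sM.1.
by rewrite rscaleDr; apply: subgroupD => //; rewrite -(Jxy g Jg); apply: gm_deg.
Qed.

Lemma grhom_dcomp (M N : grmod A X) (f : grhom M N) x m :
  f (dcomp (gm_comp M) x m) = dcomp (gm_comp N) x (f m).
Proof.
have dM := gm_sum M; have dN := gm_sum N.
move: m; apply: (direct_sum_ext dM) => [m n|m n|y c yc].
- by rewrite (dcompD dM) grhomD.
- by rewrite grhomD (dcompD dN).
have yfc := grhom_deg f yc; have [<-|yx] := eqVneq y x.
  by rewrite (dcomp_id dM) // (dcomp_id dN).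
by rewrite (dcomp_ne dM yc) ?(dcomp_ne dN yfc) ?grhom0 //; apply/eqP.
Qed.

Lemma grhom_surj_deg (M N : grmod A X) (f : grhom M N) x n :
  (forall n, exists m, f m = n) -> gm_comp N x n ->
  exists2 m, gm_comp M x m & f m = n.
Proof.
move=> fS xn; have [m Em] := fS n.
exists (dcomp (gm_comp M) x m); first exact: (dcomp_in (gm_sum M)).
by rewrite grhom_dcomp Em (dcomp_id (gm_sum N)).
Qed.

(** Preimages are chosen pointwise. Injectivity makes the choice linear, and also graded, since a
    homogeneous element has a preimage of its own degree. *)
Lemma grhom_inverse (M N : grmod A X) (f : grhom M N) :
  (forall n, exists m, f m = n) -> (forall m, f m = 0 -> m = 0) ->
  exists g : grhom N M, cancel f g /\ cancel g f.
Proof.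
move=> fS f0; have [g gK] := choice fS.
have fI m n : f m = f n -> m = n.
  move=> fmn; apply/eqP; rewrite -subr_eq0; apply/eqP/f0.
  by rewrite grhomD (morphDN (grhomD f)) fmn subrr.
have gD (m n : N) : g (m + n) = g m + g n by apply: fI; rewrite grhomD !gK.
have gZ (m : N) (a : A) : g (m :* a) = g m :* a by apply: fI; rewrite grhomZ !gK.
have gd x (n : N) : gm_comp N x n -> gm_comp M x (g n).
  by move=> /(grhom_surj_deg fS)[m xm <-]; rewrite (_ : g (f m) = m) //;
    apply: fI; rewrite gK.
by exists (GrHom gD gZ gd); split=> [m|n] /=; [apply: fI|]; rewrite gK.
Qed.

(* A, graded so that the unit has degree x. *)
Section Free.
Variable x : X.

Definition gfree_comp (y : X) : set (A^c)^o :=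
  isum (V := (A^c)^o) (gcomp A) [set g | ract x g = y].

Lemma gfree_sum : direct_sum gfree_comp.
Proof. exact: (direct_sum_regroup (gcomp_sum A)). Qed.

Lemma gfree_deg y g (m : (A^c)^o) a :
  gfree_comp y m -> gcomp A g a -> gfree_comp (ract y g) (m :* a).
Proof.
move=> ym ga; apply: (isum_map (f := fun m : A => m * a)) ym => [||h c /= xhy hc].
- exact: mul0r.
- by move=> u v; exact: mulrDl.
apply: (isum_elt (i := (h * g)%g)); first by rewrite /= ractM xhy.
exact: gcompM.
Qed.

Definition gfree : grmod A X := GrMod gfree_sum gfree_deg.

Definition gfree_one : gfree := (1 : A).

Lemma gfree_scaleE (a : gfree) (b : A) : a :* b = (a : A) * b :> A.
Proof. by []. Qed.

Lemma gfree1 : gm_comp gfree x gfree_one.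
Proof. by apply: (isum_elt (i := 1%g)); [exact: ract1|exact: gcomp1]. Qed.

End Free.

Section Hat.
Variables (W : grmod A X) (x : X) (w : W).

Definition hat_fun (a : gfree x) : W := dcomp (gm_comp W) x w :* (a : A).

Fact hatD a b : hat_fun (a + b) = hat_fun a + hat_fun b.
Proof. exact: rscaleDr. Qed.

Fact hatZ (a : gfree x) (b : A) : hat_fun (a :* b) = hat_fun a :* b.
Proof. exact: rscaleM. Qed.

Fact hat_deg y a : gm_comp (gfree x) y a -> gm_comp W y (hat_fun a).
Proof. by apply: rscale_isum (dcomp_in (gm_sum W) x w). Qed.

(* Only the component of degree x of [w] matters: [w] need not be homogeneous. *)
Definition hat : grhom (gfree x) W := GrHom hatD hatZ hat_deg.

Lemma hatE (a : gfree x) : hat a = dcomp (gm_comp W) x w :* (a : A).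
Proof. by []. Qed.

Lemma hat1 : hat (gfree_one x) = dcomp (gm_comp W) x w.
Proof. exact: rscale1. Qed.

End Hat.

Lemma hat_comp (V W : grmod A X) (f : grhom V W) x v :
  grhom_comp f (hat x v) = hat x (f v).
Proof. by apply: grhom_eq => a /=; rewrite /hat_fun grhomZ grhom_dcomp. Qed.

Lemma hat_id x : hat x (gfree_one x) = grhom_id (gfree x).
Proof.
apply: grhom_eq => a /=.
by rewrite /hat_fun (dcomp_id (gm_sum _) (gfree1 x)) [LHS]gfree_scaleE mul1r.
Qed.

(** Yoneda: A(x) represents the functor that sends W to W_x, a morphism out of A(x) being determined
    by the image of the unit. *)
Lemma hat_yoneda (W : grmod A X) x (f : grhom (gfree x) W) :
  hat x (f (gfree_one x)) = f.
Proof. by rewrite -hat_comp hat_id; apply: grhom_eq. Qed.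

Lemma hat_add (W : grmod A X) x (v w : W) : hat x (v + w) = hat x v + hat x w.
Proof.
by apply: grhom_eq => a /=; rewrite /hat_fun (dcompD (gm_sum W)) rscaleDl.
Qed.

Lemma hat_dcomp (W : grmod A X) x (w : W) :
  hat x (dcomp (gm_comp W) x w) = hat x w.
Proof.
apply: grhom_eq => a /=.
by rewrite /hat_fun (dcomp_id (gm_sum W) (dcomp_in (gm_sum W) x w)).
Qed.

Lemma hat_eq0 (W : grmod A X) x (w : W) : dcomp (gm_comp W) x w = 0 -> hat x w = 0.
Proof. by move=> w0; apply: grhom_eq => a /=; rewrite /hat_fun w0 rscale0l. Qed.

End GradedModules.

Arguments gfree {k G} A {X} x.
Arguments gfree_one {k G} A {X} x.

(** * Linear functors between categories of graded modules *)

Section GradedFunctors.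
Context {k : comPzRingType} {G H : groupType} {A : galg k G} {B : galg k H}.
Context {X : rset G} {Y : rset H}.
Implicit Types F : linfunctor (gr A X) (gr B Y).

(** [fmap] with its values retyped as [grhom], so that they can be applied to elements. *)
Definition fm F (V W : grmod A X) (f : grhom V W) : grhom (F V) (F W) := fmap F f.

Lemma fm_id F V : fm F (grhom_id V) = grhom_id (F V).
Proof. exact: (fmap_id F V). Qed.

Lemma fm_comp F (U V W : grmod A X) (g : grhom V W) (f : grhom U V) v :
  fm F (grhom_comp g f) v = fm F g (fm F f v).
Proof. by have /(congr1 (fun h : grhom _ _ => h v)) := @fmap_comp _ _ _ F U V W g f. Qed.

Lemma fmD F (V W : grmod A X) (f g : grhom V W) : fm F (f + g) = fm F f + fm F g.
Proof. by have := @fmap_lin _ _ _ F V W 1 f g; rewrite !scale1r. Qed.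

Lemma fmZ F (V W : grmod A X) c (f : grhom V W) : fm F (c *: f) = c *: fm F f.
Proof.
have := @fmap_lin _ _ _ F V W c f 0.
rewrite addr0 => E; apply: etrans E _; rewrite -[RHS]addr0.
by congr (_ + _); exact: (morphD0 (@fmD F V W)).
Qed.

Lemma fm0 F (V W : grmod A X) : fm F (0 : grhom V W) = 0.
Proof. exact/morphD0/fmD. Qed.

Lemma functor_iso_bij F F' (u : forall W, grhom (F W) (F' W)) :
  (forall V W (f : grhom V W) v, u W (fm F f v) = fm F' f (u V v)) ->
  (forall W w, exists v, u W v = w) -> (forall W v, u W v = 0 -> v = 0) ->
  functor_iso F F'.
Proof.
move=> nat uS u0.
have uV W : exists v : grhom (F' W) (F W), cancel (u W) v /\ cancel v (u W).
  exact: grhom_inverse (uS W) (u0 W).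
exists u, (fun W => projT1 (cid (uV W))).
split=> [V W f|W|W]; apply: grhom_eq => w /=; first exact: nat.
- by case: cid => v [].
- by case: cid => v [].
Qed.

End GradedFunctors.

(** * The bimodule of a functor *)

Section ExternalSum.
Context {I : choiceType} (V : I -> zmodType).

Record xsum := XSum {
  xs_fun :> forall i, V i;
  xs_fin : exists s : seq I, forall i, i \notin s -> xs_fun i = 0 }.

Implicit Types m n : xsum.

Lemma xsum_eq m n : (forall i, m i = n i) -> m = n.
Proof.
case: m n => [f ff] [g gf] /= fg.
have E : f = g by apply: functional_extensionality_dep.
by case: _ / E in gf fg *; congr XSum; apply: Prop_irrelevance.
Qed.

HB.instance Definition _ := gen_eqMixin xsum.
HB.instance Definition _ := gen_choiceMixin xsum.

Program Definition xsum0 : xsum := @XSum (fun=> 0) _.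
Next Obligation. by exists [::]. Qed.

Program Definition xsum_opp m : xsum := @XSum (fun i => - m i) _.
Next Obligation.
by case: m => m [s Hs] /=; exists s => i /Hs ->; rewrite oppr0.
Qed.

Program Definition xsum_add m n : xsum := @XSum (fun i => m i + n i) _.
Next Obligation.
case: m n => [m [s Hs]] [n [s' Hs']] /=; exists (s ++ s') => i.
by rewrite mem_cat negb_or => /andP[/Hs -> /Hs' ->]; rewrite addr0.
Qed.

Fact xsum_addA : associative xsum_add.
Proof. by move=> m n p; apply: xsum_eq => i /=; rewrite addrA. Qed.
Fact xsum_addC : commutative xsum_add.
Proof. by move=> m n; apply: xsum_eq => i /=; rewrite addrC. Qed.
Fact xsum_add0 : left_id xsum0 xsum_add.
Proof. by move=> m; apply: xsum_eq => i /=; rewrite add0r. Qed.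
Fact xsum_addN : left_inverse xsum0 xsum_opp xsum_add.
Proof. by move=> m; apply: xsum_eq => i /=; rewrite addNr. Qed.

HB.instance Definition _ := GRing.isZmodule.Build xsum
  xsum_addA xsum_addC xsum_add0 xsum_addN.

Lemma xsE_D m n i : (m + n) i = m i + n i. Proof. by []. Qed.
Lemma xsE_N m i : (- m) i = - m i. Proof. by []. Qed.
Lemma xsE_0 i : (0 : xsum) i = 0. Proof. by []. Qed.

Program Definition xinj i (v : V i) : xsum := @XSum (@dfwith I V (fun=> 0) i v) _.
Next Obligation.
by exists [:: i] => j; rewrite inE => /eqP ji; rewrite dfwith_out // eq_sym; apply/eqP.
Qed.

Lemma xinj_in i (v : V i) : xinj v i = v. Proof. exact: dfwith_in. Qed.

Lemma xinj_out i (v : V i) j : j <> i -> xinj v j = 0.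
Proof. by move=> ji; apply: dfwith_out; rewrite eq_sym; apply/eqP. Qed.

Lemma xinj0 i : xinj (0 : V i) = 0.
Proof.
apply: xsum_eq => j; have [->|/eqP ji] := eqVneq j i; first by rewrite xinj_in.
by rewrite xinj_out.
Qed.

Lemma xinjD i : {morph @xinj i : u v / u + v}.
Proof.
move=> u v; apply: xsum_eq => j; rewrite xsE_D.
have [->|/eqP ji] := eqVneq j i; first by rewrite !xinj_in.
by rewrite !xinj_out // addr0.
Qed.

Lemma xsum_ind (P : xsum -> Prop) :
  P 0 -> (forall i (v : V i) m, P m -> P (xinj v + m)) -> forall m, P m.
Proof.
move=> P0 PD m; case: (xs_fin m) => s; elim: s => [|i s IH] in m * => Hs.
  by rewrite (_ : m = 0) //; apply: xsum_eq => i; rewrite Hs.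
rewrite -[m](subrKC (xinj (m i))); apply: PD; apply: IH => j js.
have [->|/eqP ji] := eqVneq j i; first by rewrite xsE_D xsE_N xinj_in subrr.
by rewrite xsE_D xsE_N xinj_out // subr0 Hs // inE negb_or js andbT; apply/eqP.
Qed.



End ExternalSum.

Section Watts.
Context {k : comPzRingType} {G H : groupType} {A : galg k G} {B : galg k H}.
Context {X : rset G} {Y : rset H} (F : linfunctor (gr A X) (gr B Y)).

Definition wmod : Type := xsum (fun x : X => F (gfree A x)).

HB.instance Definition _ := GRing.Zmodule.on wmod.

Implicit Types m n : wmod.

Section Pairing.
Variable W : grmod A X.

(* The map W x (+)_x F(A(x)) -> F(W) that induces W \hat\ot_A wmod -> F(W). *)
Definition wpair (w : W) m : F W := fsum (fun x => fm F (hat x w) (m x)).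

Lemma wpair_fin w m : fin_supp (fun x => fm F (hat x w) (m x) : F W).
Proof. by case: (xs_fin m) => s Hs; exists s => x /Hs ->; rewrite grhom0. Qed.

Lemma wpairDl v w m : wpair (v + w) m = wpair v m + wpair w m.
Proof.
rewrite -fsumD; try exact: wpair_fin.
by apply: eq_fsum => x; rewrite hat_add fmD.
Qed.

Lemma wpairDr w m n : wpair w (m + n) = wpair w m + wpair w n.
Proof.
rewrite -fsumD; try exact: wpair_fin.
by apply: eq_fsum => x; rewrite xsE_D grhomD.
Qed.

Lemma wpair_inj w x (v : F (gfree A x)) :
  wpair w (xinj (V := fun x => F (gfree A x)) v) = fm F (hat x w) v.
Proof.
rewrite /wpair (@fsum1 _ _ x) ?xinj_in // => y yx.
by rewrite xinj_out // grhom0.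
Qed.

Lemma wpair_hom x w m : gm_comp W x w -> wpair w m = fm F (hat x w) (m x).
Proof.
move=> xw; rewrite /wpair (@fsum1 _ _ x) // => y yx.
by rewrite hat_eq0 ?fm0 // (dcomp_ne (gm_sum W) xw) // => /esym.
Qed.

End Pairing.

Lemma wpair_nat V W (f : grhom V W) v m : wpair (f v) m = fm F f (wpair v m).
Proof.
rewrite /wpair (fsum_morph (grhomD _)); last exact: wpair_fin.
by apply: eq_fsum => x; rewrite -hat_comp fm_comp.
Qed.

(** For [c] of degree g, the coordinate at x depends only on the coordinate of [m] at xg, so the
    support of [m] is translated by the inverse of g. *)
Lemma wpair_act_fin (a : A) m :
  exists s : seq X, forall x, x \notin s -> wpair (a : gfree A x) m = 0.
Proof.
elim/(direct_sum_ind (gcomp_sum A)): a => [|g c a gc [s Hs]].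
  by exists [::] => x _; apply: (morphD0 (fun v w => wpairDl v w m)).
case: (xs_fin m) => r Hr; exists (s ++ map (fun x => ract x g^-1%g) r) => x.
rewrite mem_cat negb_or => /andP[/Hs Ea xr]; rewrite wpairDl Ea addr0.
have xc : gm_comp (gfree A x) (ract x g) c by apply: isum_elt gc.
rewrite (wpair_hom m xc) Hr ?grhom0 //; apply: contra xr => xr.
by apply/mapP; exists (ract x g); rewrite // -ractM mulgV ract1.
Qed.

(** An element of degree g lies in degree xg of A(x). Left multiplication by it is a morphism from
    A(xg) to A(x), and F of this morphism carries the summand at xg to the one at x. *)
Definition wact (a : A) m : wmod := XSum (wpair_act_fin a m).

Lemma wactE a m x : wact a m x = wpair (a : gfree A x) m.
Proof. by []. Qed.

(** For [w] homogeneous of degree x, [w :* a] is the image of [a] under [hat x w], so naturality of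
    [wpair] applies. *)
Lemma wpair_balanced (W : grmod A X) (w : W) a m : wpair (w :* a) m = wpair w (wact a m).
Proof.
elim/(direct_sum_ind (gm_sum W)): w => [|x c w xc IH].
  by rewrite rscale0l !(morphD0 (fun v w => wpairDl v w _)).
rewrite rscaleDl !wpairDl IH; congr (_ + _).
rewrite (wpair_hom _ xc) wactE -wpair_nat; congr (wpair _ m).
by rewrite hatE (dcomp_id (gm_sum W)).
Qed.

Lemma wpair_one x m : wpair (gfree_one A x) m = m x.
Proof. by rewrite (wpair_hom _ (gfree1 x)) hat_id fm_id. Qed.

(** The coordinate at x is [wpair_balanced] for W = A(x). *)
Fact wactA a b m : wact a (wact b m) = wact (a * b) m.
Proof. by apply: xsum_eq => x; rewrite !wactE -wpair_balanced. Qed.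
Fact wact1 : left_id 1 wact.
Proof. by move=> m; apply: xsum_eq => x; rewrite wactE wpair_one. Qed.
Fact wactDr : right_distributive wact +%R.
Proof. by move=> a m n; apply: xsum_eq => x; rewrite wactE wpairDr. Qed.
Fact wactDl m : {morph wact^~ m : a b / a + b}.
Proof. by move=> a b; apply: xsum_eq => x; rewrite wactE wpairDl. Qed.

HB.instance Definition _ := GRing.Zmodule_isLmodule.Build A wmod
  wactA wact1 wactDr wactDl.

Lemma wmod_scaleE (a : A) m x : (a *: m) x = wpair (a : gfree A x) m.
Proof. by []. Qed.

Fact wmr_fin m (b : B) : exists s : seq X, forall x, x \notin s -> m x :* b = 0.
Proof. by case: (xs_fin m) => s Hs; exists s => x /Hs ->; rewrite rscale0l. Qed.

Definition wmr m (b : B) : wmod := XSum (wmr_fin m b).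

Lemma wpair_wmr (W : grmod A X) (w : W) m b : wpair w (wmr m b) = wpair w m :* b.
Proof.
rewrite /wpair (fsum_morph (f := fun v => v :* b)); last exact: wpair_fin.
  by apply: eq_fsum => x; rewrite -grhomZ.
by move=> u v; rewrite rscaleDl.
Qed.

Program Definition wbimod : bimod A B := @BiMod k A B wmod wmr _ _ _ _ _ _.
Next Obligation. by apply: xsum_eq => x; apply: rscaleDl. Qed.
Next Obligation. by apply: xsum_eq => x; apply: rscaleDr. Qed.
Next Obligation. by apply: xsum_eq => x; apply: rscaleM. Qed.
Next Obligation. by apply: xsum_eq => x; apply: rscale1. Qed.
Next Obligation. by apply: xsum_eq => x; rewrite wmod_scaleE wpair_wmr. Qed.
Next Obligation.
apply: xsum_eq => x; rewrite wmod_scaleE.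
have xc : gm_comp (gfree A x) x (kin A c).
  by rewrite -[kin A c]mul1r; apply: gm_compk (gfree1 x).
(* Left multiplication by c on A(x) is c times the identity, and F is k-linear. *)
rewrite (wpair_hom _ xc) (_ : hat x _ = c *: grhom_id (gfree A x)) ?fmZ ?fm_id //.
by apply: grhom_eq => a; rewrite hatE (dcomp_id (gm_sum _) xc); apply: kinC.
Qed.

Definition wcomp (i : X * Y) : set wbimod := fun m : wmod =>
  (forall x, x <> i.1 -> m x = 0) /\ gm_comp (F (gfree A i.1)) i.2 (m i.1).

Lemma xinj_wcomp x y (v : F (gfree A x)) : gm_comp (F (gfree A x)) y v ->
  wcomp (x, y) (xinj (V := fun x => F (gfree A x)) v).
Proof. by move=> yv; split=> [z zx|]; [rewrite xinj_out|rewrite xinj_in]. Qed.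

Lemma wcomp_sum : direct_sum wcomp.
Proof.
have dF x := gm_sum (F (gfree A x)); split=> [[x y]|m|[x y] m [mx xym] Hm].
- split; first by split=> [//|]; apply: (comp_subgroup (dF x) y).1.
  move=> m n [m0 ym] [n0 yn]; split=> [z zx|].
    by rewrite xsE_D xsE_N m0 // n0 // subrr.
  exact: (comp_subgroup (dF x) y).2.
- elim/(@xsum_ind X (fun x => F (gfree A x))): m => [|x v m IH]; first exact: isum0.
  apply: isumD IH; elim/(direct_sum_ind (dF x)): v => [|y c v yc IH].
    by rewrite xinj0; apply: isum0.
  rewrite xinjD; apply: isumD IH; apply: (isum_elt (i := (x, y))) => //.
  exact: xinj_wcomp.
apply: xsum_eq => z; rewrite xsE_0; have [->{z}|/eqP/mx //] := eqVneq z x.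
have [_ _ D] := dF x; apply: (D y _ xym).
apply: (isum_map (f := fun n : wmod => n x)) Hm => // -[x' y'] n /= xy [nx yn].
have [E|/eqP xx'] := eqVneq x x'; last by rewrite nx //; apply: isum0.
by case: _ / E in xy nx yn *; apply: isum_elt yn => /= E; apply: xy; rewrite E.
Qed.

Lemma wcomp_deg g x y h a (p : wbimod) b :
  gcomp A g a -> wcomp (x, y) p -> gcomp B h b ->
  wcomp (lact g x, ract y h) (bmr (a *: p) b).
Proof.
move=> ga [px yp] hb; split=> [z /= zx|].
  rewrite -[LHS]/(wpair (a : gfree A z) p :* b).
  have zc : gm_comp (gfree A z) (ract z g) a by apply: isum_elt ga.
  rewrite (wpair_hom _ zc) px ?grhom0 ?rscale0l //= => zgx; apply: zx.
  by rewrite -zgx /lact -ractM mulgV ract1.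
set z := lact g x.
suff : gm_comp (F (gfree A z)) y (wpair (a : gfree A z) p) by move/gm_deg; apply.
have xc : gm_comp (gfree A z) x a.
  by apply: isum_elt ga; rewrite /= /z /lact -ractM mulVg ract1.
by rewrite (wpair_hom _ xc); apply: grhom_deg.
Qed.

Definition watts : grbimod A B X Y := GrBiMod wcomp_sum wcomp_deg.

End Watts.

(** * Cokernels and generators of completed tensor products *)

Section Cokernel.
Context {k : comPzRingType} {G : groupType} {A : galg k G} {X : rset G}.
Context {U V : grmod A X} (f : grhom U V).

Definition gim_pred : {pred V} := fun v => `[< exists u, f u = v >].

Fact gim_closed : zmod_closed gim_pred.
Proof.
split=> [|v w /asboolP[u <-] /asboolP[u' <-]]; apply/asboolP.
  by exists 0; rewrite grhom0.
by exists (u - u'); rewrite grhomD (morphDN (grhomD f)).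
Qed.

HB.instance Definition _ := GRing.isZmodClosed.Build V gim_pred gim_closed.

Definition gcoker_car := Quotient.quot gim_pred.

HB.instance Definition _ := GRing.Zmodule.on gcoker_car.

Definition gcoker_pi : V -> gcoker_car := \pi_(gcoker_car)%qT.

Lemma gcoker_piD : {morph gcoker_pi : v w / v + w}.
Proof. exact: raddfD. Qed.

Lemma gcoker_pi_eq v w : gcoker_pi v = gcoker_pi w <-> exists u, f u = v - w.
Proof.
split=> [/eqP|H]; last apply/eqP; rewrite /gcoker_pi -Quotient.idealrBE.
  by move/asboolP.
exact/asboolP.
Qed.

Lemma gcoker_piP (q : gcoker_car) : gcoker_pi (repr q) = q.
Proof. exact: reprK. Qed.

Definition gcoker_scale (a : A^c) (q : gcoker_car) : gcoker_car :=
  gcoker_pi (a *: repr q).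

Lemma gcoker_piZ (a : A^c) v : gcoker_scale a (gcoker_pi v) = gcoker_pi (a *: v).
Proof.
have [u Eu] := (gcoker_pi_eq _ _).1 (gcoker_piP (gcoker_pi v)).
by apply/gcoker_pi_eq; exists (u :* a); rewrite grhomZ Eu /rscale scalerBr.
Qed.

Fact gcoker_scaleA a b q : gcoker_scale a (gcoker_scale b q) = gcoker_scale (a * b) q.
Proof. by rewrite -[q]gcoker_piP !gcoker_piZ scalerA. Qed.
Fact gcoker_scale1 : left_id 1 gcoker_scale.
Proof. by move=> q; rewrite -[q]gcoker_piP gcoker_piZ scale1r. Qed.
Fact gcoker_scaleDr : right_distributive gcoker_scale +%R.
Proof.
move=> a q r; rewrite -[q]gcoker_piP -[r]gcoker_piP -gcoker_piD !gcoker_piZ.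
by rewrite scalerDr gcoker_piD.
Qed.
Fact gcoker_scaleDl q : {morph gcoker_scale^~ q : a b / a + b}.
Proof.
by move=> a b; rewrite -[q]gcoker_piP !gcoker_piZ scalerDl gcoker_piD.
Qed.

HB.instance Definition _ := GRing.Zmodule_isLmodule.Build A^c gcoker_car
  gcoker_scaleA gcoker_scale1 gcoker_scaleDr gcoker_scaleDl.

Definition gcoker_comp (x : X) : set gcoker_car :=
  fun q => exists2 v, gm_comp V x v & gcoker_pi v = q.

Lemma gcoker_isum (J : set X) v :
  isum (gm_comp V) J v -> isum gcoker_comp J (gcoker_pi v).
Proof.
apply: isum_map; [exact/morphD0/gcoker_piD|exact: gcoker_piD|].
by move=> x c Jx xc; apply: (isum_elt Jx); exists c.
Qed.

Lemma gcoker_isum_lift (J : set X) q :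
  isum gcoker_comp J q -> exists2 v, isum (gm_comp V) J v & gcoker_pi v = q.
Proof.
elim=> [|x c r Jx [v xv <-] _ [w Jw <-]].
  by exists 0; [exact: isum0|exact/morphD0/gcoker_piD].
by exists (v + w); [exact: isumC Jx xv Jw|exact: gcoker_piD].
Qed.

Lemma gcoker_sum : direct_sum gcoker_comp.
Proof.
have dV := gm_sum V; split=> [x|q|x q [v xv <-] /gcoker_isum_lift[w Jw]].
- split; first by exists 0; [exact: (comp_subgroup dV x).1|exact/morphD0/gcoker_piD].
  move=> _ _ [v xv <-] [w xw <-]; exists (v - w); first exact: (comp_subgroup dV x).2.
  by rewrite gcoker_piD (morphDN gcoker_piD).
- by rewrite -[q]gcoker_piP; apply: gcoker_isum; case: dV.
move=> /gcoker_pi_eq[u Eu].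
rewrite -(morphD0 gcoker_piD); apply/gcoker_pi_eq.
(* Here [f u = w - v], and [w] has no component of degree x, so the component of [u] of degree x is
   sent to [- v]. *)
exists (- dcomp (gm_comp U) x u).
rewrite (morphDN (grhomD f)) grhom_dcomp Eu (dcompD dV) (morphDN (dcompD dV x)).
by rewrite (dcomp_id dV xv) (dcomp_isum dV _ Jw) // add0r opprK subr0.
Qed.

Lemma gcoker_deg x g (q : gcoker_car) a :
  gcoker_comp x q -> gcomp A g a -> gcoker_comp (ract x g) (q :* a).
Proof.
move=> [v xv <-] ga; exists (v :* a); first exact: gm_deg.
by rewrite -gcoker_piZ.
Qed.

(** The cokernel serves to detect surjectivity: [f] is onto once the projection onto the cokernel
    vanishes. *)
Definition gcoker : grmod A X := GrMod gcoker_sum gcoker_deg.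

Program Definition gcoker_proj : grhom V gcoker :=
  @GrHom _ _ _ _ V gcoker gcoker_pi _ _ _.
Next Obligation. exact: gcoker_piD. Qed.
Next Obligation. by rewrite -gcoker_piZ. Qed.
Next Obligation. by exists m. Qed.

Lemma gcoker_projE v : gcoker_proj v = 0 <-> exists u, f u = v.
Proof.
have <- : gcoker_pi 0 = 0 := morphD0 gcoker_piD.
by split=> [/gcoker_pi_eq|[u Eu]]; [|apply/gcoker_pi_eq; exists u]; rewrite subr0.
Qed.

End Cokernel.

Section CompletedTensorTheory.
Context {k : comPzRingType} {G H : groupType} {A : galg k G} {B : galg k H}.
Context {X : rset G} {Y : rset H} {P : grbimod A B X Y} {M : grmod A X}.

(* The element m \ot p of M \hat\ot_A P; zero when m \ot p does not lie there. *)
Definition cmk (m : M) (p : P) : ctens P M :=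
  insubd (0 : submod_of (ctens_mod P M)) (m \ot p).

Lemma cmk_val x m p : gm_comp M x m -> gb_row P x p ->
  submod_val (cmk m p : submod_of _) = m \ot p.
Proof.
move=> xm xp; rewrite [LHS]insubdK //; apply/asboolP.
by apply: kspan_elt; exists x, m, p.
Qed.

Lemma gb_row_comp x y (p : P) : gb_comp P (x, y) p -> gb_row P x p.
Proof. by move=> xyp; apply: isum_elt xyp. Qed.

Lemma gb_col_comp x y (p : P) : gb_comp P (x, y) p -> gb_col P y p.
Proof. by move=> xyp; apply: isum_elt xyp. Qed.

Lemma ctens_compE y (t : ctens P M) : gm_comp (ctens P M) y t =
  ctens_set (N := P) (fun x => gb_comp P (x, y))
    (submod_val (t : submod_of _) : tens M P).
Proof. by []. Qed.

Lemma cmk_comp x y m p : gm_comp M x m -> gb_comp P (x, y) p ->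
  gm_comp (ctens P M) y (cmk m p).
Proof.
move=> xm xyp.
by rewrite ctens_compE (cmk_val xm (gb_row_comp xyp)); apply: kspan_elt; exists x, m, p.
Qed.

Lemma ctens_comp_ind y (Q : ctens P M -> Prop) : Q 0 ->
  (forall x m p t, gm_comp M x m -> gb_comp P (x, y) p -> Q t -> Q (cmk m p + t)) ->
  forall t, gm_comp (ctens P M) y t -> Q t.
Proof.
move=> Q0 QD t; rewrite ctens_compE.
move E: (submod_val t : tens M P) => u yu.
elim: yu t E => [|c e v [x [m [p [xm xyp ->]]]] _ IH] t Et.
  by rewrite (_ : t = 0) //; apply: val_inj.
(* The scalar [c] is absorbed by [m], whose degree is unchanged, so sums of pure tensors suffice. *)
have xm' := gm_compk c xm; rewrite -[t](subrKC (cmk (m :* kin A c) p)).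
apply: (QD _ _ _ _ xm' xyp); apply: IH.
rewrite [LHS](_ : _ = submod_val t - submod_val (cmk (m :* kin A c) p : submod_of _)) //.
by rewrite Et (cmk_val xm' (gb_row_comp xyp)) tens_kscaleE addrC addKr.
Qed.

Lemma ctens_ext (W : zmodType) (f g : ctens P M -> W) :
  {morph f : s t / s + t} -> {morph g : s t / s + t} ->
  (forall x y m p, gm_comp M x m -> gb_comp P (x, y) p -> f (cmk m p) = g (cmk m p)) ->
  f =1 g.
Proof.
move=> fD gD fg; apply: (direct_sum_ext (gm_sum (ctens P M))) => // y.
apply: ctens_comp_ind => [|x m p t xm xyp IH].
  by rewrite (morphD0 fD) (morphD0 gD).
by rewrite fD gD IH (fg x y).
Qed.

Lemma cmk_add x m n p : gm_comp M x m -> gm_comp M x n -> gb_row P x p ->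
  cmk (m + n) p = cmk m p + cmk n p.
Proof.
move=> xm xn xp; apply: val_inj.
rewrite [RHS](_ : _ = submod_val (cmk m p : submod_of _) +
  submod_val (cmk n p : submod_of _)) //.
rewrite [LHS](cmk_val _ xp); first by rewrite !(cmk_val _ xp) // tens_mkDl.
exact: subgroupD (comp_subgroup (gm_sum M) x) _ _.
Qed.

End CompletedTensorTheory.

Lemma ctens_map_cmk (k : comPzRingType) (G H : groupType) (A : galg k G) (B : galg k H)
    (X : rset G) (Y : rset H) (P : grbimod A B X Y) (M N : grmod A X)
    (f : grhom M N) x m p :
  gm_comp M x m -> gb_row P x p -> ctens_map P f (cmk m p) = cmk (f m) p.
Proof.
move=> xm xp; apply: val_inj; rewrite [RHS](cmk_val (grhom_deg f xm) xp).
by rewrite [LHS]/= (cmk_val xm xp) tens_mapE.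
Qed.

(** * Graded pairings with dual bases *)

(** One half of the dual basis lemma: arbitrary preimages [w i] of the [h (e i)] determine the lift,
    v |-> sum_i f_i(v) w_i. *)
Lemma dual_basis_fgproj (R : pzRingType) (V : lmodType R) n (e : 'I_n -> V)
    (f : 'I_n -> V -> R) :
  (forall i, {morph f i : v w / v + w}) ->
  (forall i a v, f i (a *: v) = a * f i v) ->
  (forall v, v = \sum_(i < n) f i v *: e i) -> fgproj V.
Proof.
move=> fD fZ eE; split; first by exists n, e => v; exists (f^~ v).
move=> W W' g h gS; have [w gw] := choice (fun i => gS (h (e i))).
pose r (v : V) : W := \sum_(i < n) f i v *: w i.
have rlin : linear r.
  move=> a u v; rewrite /r scaler_sumr -big_split /=; apply: eq_bigr => i _.
  by rewrite fD fZ scalerDl scalerA.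
exists (HB.pack_for {linear V -> W} r (GRing.isLinear.Build _ _ _ _ r rlin)) => v /=.
rewrite [v in RHS]eE !linear_sum; apply: eq_bigr => i _.
by rewrite !linearZ /= gw.
Qed.

(** The other half: projectivity splits the surjection from R^n given by n generators, and the
    coordinates of the section are the f_i. *)
Lemma fgproj_dual_basis (R : pzRingType) (V : lmodType R) : fgproj V ->
  exists n (e : 'I_n -> V) (f : 'I_n -> V -> R),
  [/\ forall i, {morph f i : v w / v + w}, forall i a v, f i (a *: v) = a * f i v
    & forall v, v = \sum_(i < n) f i v *: e i].
Proof.
move=> [[n [e eS]] pV]; pose F : lmodType R := {ffun 'I_n -> R^o}.
pose g (c : F) : V := \sum_(i < n) (c i : R) *: e i.
have glin : linear g.
  move=> a c d; rewrite /g scaler_sumr -big_split /=; apply: eq_bigr => i _.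
  by rewrite !ffunE scalerDl scalerA.
pose gl := HB.pack_for {linear F -> V} g (GRing.isLinear.Build _ _ _ _ g glin).
have gS v : exists c, gl c = v.
  have [c ->] := eS v; exists [ffun i => c i]; apply: eq_bigr => i _.
  by rewrite ffunE.
have [h hK] := pV _ _ gl (idfun : {linear V -> V}) gS.
exists n, e, (fun i v => h v i); split=> [i v w|i a v|v].
- by rewrite linearD ffunE.
- by rewrite linearZ ffunE.
- exact: esym (hK v).
Qed.

Section BimoduleComponents.
Context {k : comPzRingType} {G H : groupType} {A : galg k G} {B : galg k H}.
Context {X : rset G} {Y : rset H} (P : grbimod A B X Y).

Lemma gb_row_sum : direct_sum (gb_row P).
Proof. exact: (direct_sum_regroup (gb_sum P)). Qed.

Lemma gb_col_sum : direct_sum (gb_col P).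
Proof. exact: (direct_sum_regroup (gb_sum P)). Qed.

Lemma gb_col_sum_comp y (s : seq X) (p : P) : gb_col P y p -> uniq s ->
  (forall z, z \notin s -> dcomp (gb_comp P) (z, y) p = 0) ->
  p = \sum_(z <- s) dcomp (gb_comp P) (z, y) p.
Proof.
have dP := gb_sum P => yp us Hs; rewrite -{1}[p](dcomp_sum dP).
rewrite (@fsumE _ _ [seq (z, y) | z <- s]) ?big_map //.
  by rewrite map_inj_uniq // => z z' [].
move=> [z y'] Hz; have [E|yy'] := pselect (y' = y).
  by case: _ / E in Hs Hz *; apply: Hs; apply: contra Hz => Hz; apply/mapP; exists z.
by move: yp => /(isumP dP); apply.
Qed.

(** For [a] of degree g the product has degree (zg^-1, y), and zg^-1 = x exactly when [a] has degree
    z in A(x). So a component of the product comes from a component of [a]. *)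
Lemma gb_dcompZ x z y a p : gb_comp P (z, y) p ->
  dcomp (gb_comp P) (x, y) (a *: p) = (dcomp (gfree_comp x) z a : A) *: p.
Proof.
move=> zyp; have dP := gb_sum P; have dA := gfree_sum (A := A) x.
move: a; apply: (direct_sum_ext (gcomp_sum A)) => [a b|a b|g a ga].
- by rewrite scalerDl (dcompD dP).
- by rewrite -scalerDl; congr (_ *: _); apply: (dcompD dA).
have xga : gfree_comp x (ract x g) a by apply: isum_elt ga.
have gzp := gb_degl ga zyp; have [E|xgz] := pselect (ract x g = z).
  case: _ / E in zyp gzp *; rewrite (dcomp_id dA) // (dcomp_id dP) //.
  by rewrite /lact -ractM mulgV ract1 in gzp.
rewrite (dcomp_ne dA xga) // (dcomp_ne dP gzp) ?scale0r // => -[E].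
by apply: xgz; rewrite -E /lact -ractM mulVg ract1.
Qed.

End BimoduleComponents.

Section Pairings.
Context {k : comPzRingType} {G H : groupType} {A : galg k G} {B : galg k H}.
Context {X : rset G} {Y : rset H}.
Variables (P : grbimod A B X Y) (Q : grbimod B A Y X).
Implicit Types (p : P) (q : Q) (a : A) (b : B).

(** An axiomatic form of evaluation between P and its graded dual: a map of (A, A)-bimodules from P
    \ot_B Q to A. The degree condition places psi(p, q) in degree z of A(x). *)
Record graded_pairing (psi : P -> Q -> A) : Prop := GradedPairing {
  gpDl : forall p p' q, psi (p + p') q = psi p q + psi p' q;
  gpDr : forall p q q', psi p (q + q') = psi p q + psi p q';
  gpZl : forall a p q, psi (a *: p) q = a * psi p q;
  gpZr : forall p q a, psi p (bmr q a) = psi p q * a;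
  gpA : forall p b q, psi (bmr p b) q = psi p (b *: q);
  gp_deg : forall x y z p q, gb_comp P (x, y) p -> gb_comp Q (y, z) q ->
    isum (gcomp A) [set g | ract x g = z] (psi p q);
  gp_ne : forall x y y' z p q, y <> y' ->
    gb_comp P (x, y) p -> gb_comp Q (y', z) q -> psi p q = 0 }.

(* The last two conditions say that (p_i) and (q_i) are dual bases of P_y
   and of {}_y Q. *)
Definition dual_bases (psi : P -> Q -> A) (y : Y) : Prop :=
  exists n (x : 'I_n -> X) (p : 'I_n -> P) (q : 'I_n -> Q),
  [/\ forall i, gb_comp P (x i, y) (p i), forall i, gb_comp Q (y, x i) (q i),
      forall r, gb_col P y r -> r = \sum_(i < n) psi r (q i) *: p i
    & forall s, gb_row Q y s -> s = \sum_(i < n) bmr (q i) (psi (p i) s)].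

Section PairingTheory.
Context {psi : P -> Q -> A} (gp : graded_pairing psi).

Let psiDl q : {morph psi^~ q : p p' / p + p'}.
Proof. by move=> p p'; apply: (gpDl gp). Qed.

Let psiDr p : {morph psi p : q q' / q + q'}.
Proof. by move=> q q'; apply: (gpDr gp). Qed.

Let dP := gb_sum P.
Let dQ := gb_sum Q.



Lemma gp_col_row y y' p q : y <> y' -> gb_col P y p -> gb_row Q y' q -> psi p q = 0.
Proof.
move=> yy' yp y'q; elim: yp => [|[x z] c v /= -> xyc _ IH].
  exact: (morphD0 (psiDl q)).
rewrite (gpDl gp) IH addr0.
elim: y'q => [|[z' x'] d u /= -> dq _ IH']; first exact: (morphD0 (psiDr c)).
by rewrite (gpDr gp) IH' addr0 (gp_ne gp yy' xyc dq).
Qed.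

(** The counterpart of [gb_dcompZ]: for p of degree (x, y), the second degree of q becomes the
    degree of psi(p, q) in A(x). *)
Lemma gp_dcomp x y z p q : gb_comp P (x, y) p ->
  psi p (dcomp (gb_comp Q) (y, z) q) = dcomp (gfree_comp x) z (psi p q) :> A.
Proof.
move=> xyp; have dA := gfree_sum (A := A) x; move: q.
apply: (direct_sum_ext dQ) => [q q'|q q'|[y' z'] q y'z'q].
- by rewrite (dcompD dQ) (gpDr gp).
- by rewrite (gpDr gp); apply: (dcompD dA).
have [Ey|yy'] := pselect (y = y'); last first.
  rewrite (gp_ne gp yy' xyp y'z'q) (dcomp0 dA) (dcomp_ne dQ y'z'q).
    exact: (morphD0 (psiDr p)).
  by move=> [/esym].
case: _ / Ey in y'z'q *; have xzq := gp_deg gp xyp y'z'q.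
have [E|zz'] := pselect (z' = z).
  case: _ / E in y'z'q xzq *; rewrite (dcomp_id dQ) //.
  by apply/esym/(dcomp_id dA).
rewrite (dcomp_ne dQ y'z'q) => [|[] //]; rewrite (morphD0 (psiDr p)).
exact/esym/(dcomp_ne dA xzq).
Qed.

Lemma gpl0 q : psi 0 q = 0.
Proof. exact: (morphD0 (psiDl q)). Qed.

Lemma gp_row p y q : gb_col P y p -> psi p (dcomp (gb_row Q) y q) = psi p q.
Proof.
have dR := gb_row_sum Q => yp; move: q.
apply: (direct_sum_ext dR) => [q q'|q q'|y' q y'q]; rewrite ?(dcompD dR) ?(gpDr gp) //.
have [E|yy'] := pselect (y = y'); first by rewrite (dcomp_id dR) // E.
rewrite (gp_col_row yy' yp y'q) (dcomp_ne dR y'q) => [|/esym //].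
exact: (morphD0 (psiDr p)).
Qed.

Lemma gp_dual_fin q : finite_set [set y | ~ forall p, gb_col P y p -> psi p q = 0].
Proof.
elim/(direct_sum_ind (gb_row_sum Q)): q => [|y c q yc].
  apply: (sub_finite_set _ (finite_set0 Y)) => y /= Hy; apply: Hy => p _.
  exact: (morphD0 (psiDr p)).
move=> /(conj (finite_set1 y)); rewrite -finite_setU.
apply: sub_finite_set => z /= Hz; apply: contrapT => /not_orP[/= zy /contrapT Hq].
apply: Hz => p zp; rewrite (gpDr gp) (Hq p zp) addr0.
exact: (gp_col_row zy zp yc).
Qed.

Definition gp_dual q : gdual P :=
  GDual (fun p p' => gpDl gp p p' q) (fun a p => gpZl gp a p q) (gp_dual_fin q).

Hypothesis basis : forall y, dual_bases psi y.

(** The component of q in {}_y Q is recovered from the values psi(p_i, q) by the expansion in the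
    dual basis. *)
Lemma gp_dual_inj q : (forall p, psi p q = 0) -> q = 0.
Proof.
move=> q0; apply: (dcomp_inj (gb_row_sum Q)) => y; rewrite (dcomp0 (gb_row_sum Q)).
have [n [x [p [s [Hp _ _ qE]]]]] := basis y.
rewrite (qE _ (dcomp_in (gb_row_sum Q) y q)) big1 // => i _.
by rewrite (gp_row _ (gb_col_comp (Hp i))) q0 bmr0.
Qed.

(** Expanding the argument in the p_i shows that sum_i q_i f(p_i) represents f on P_y. Since f
    vanishes on almost all P_y, finitely many of these elements add up to a representative on P. *)
Lemma gp_dual_surj (f : gdual P) : exists q, forall p, psi p q = f p.
Proof.
have Hy y : exists q, gb_row Q y q /\ forall p, gb_col P y p -> psi p q = f p.
  have [n [x [p [q [Hp Hq pE _]]]]] := basis y.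
  exists (\sum_(i < n) bmr (q i) (f (p i))); split=> [|r yr].
    apply: (comp_sum (gb_row_sum Q)) => i.
    exact: (@gb_rowZ _ _ _ _ _ _ _ Q y (f (p i)) (q i) (gb_row_comp (Hq i))).
  rewrite [in RHS](pE r yr) (morphD_sum _ _ (gdualD f)) (morphD_sum _ _ (psiDr r)).
  by apply: eq_bigr => i _; rewrite gdualZ (gpZr gp).
have [u Hu] := choice Hy; have [s Es] := (finite_seqP _).1 (gdual_fin f).
exists (\sum_(y <- undup s) u y).
apply: (direct_sum_ext (gb_col_sum P)) => [p p'|p p'|y p yp].
- by rewrite (gpDl gp).
- by rewrite gdualD.
rewrite (morphD_sum _ _ (psiDr p)) -(Hu y).2 //.
have u0 z : z <> y -> psi p (u z) = 0.
  by move=> /nesym zy; apply: (gp_col_row zy yp (Hu z).1).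
have [ys|/negP ys] := boolP (y \in undup s).
  by rewrite (bigD1_seq y) ?undup_uniq //= big1 ?addr0 // => z /eqP /u0.
rewrite big_seq big1 => [|z zs]; last by apply: u0 => zy; apply: ys; rewrite -zy.
rewrite (Hu y).2 //; apply/esym; move: p yp {u0}; apply: contrapT => Hf; apply: ys.
by rewrite mem_undup; have : [set` s] y by rewrite -Es.
Qed.

Lemma gp_dual_comp y x q :
  gb_comp Q (y, x) q <-> gdual_comp P (y, x) (gp_dual q).
Proof.
split=> [yxq|[/= q0 qx]].
  split=> [y' p /= yy'|x' p x'p] /=.
    by move=> /gp_col_row; apply; [exact: yy'|exact: gb_row_comp yxq].
  apply: (isum_ind_in (U := fun p => isum _ _ (psi p q))) x'p => [|[_ y'] /= -> r x'y'r].
    have sA := isum_subgroup [set g | ract x' g = x] (comp_subgroup (gcomp_sum A)).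
    split=> [|u v]; first by rewrite (morphD0 (psiDl q)); exact: sA.1.
    by move=> Hu Hv; rewrite psiDl (morphDN (psiDl q)); exact: sA.2.
  have [E|yy'] := pselect (y' = y); first by rewrite E in x'y'r; apply: gp_deg yxq.
  by rewrite (gp_ne gp yy' x'y'r yxq); apply: isum0.
(* By nondegeneracy it suffices that each other component of [q] pairs to zero with every
   homogeneous element of P. *)
apply/(compP dQ) => -[y' x'] ne; apply: gp_dual_inj.
apply: (direct_sum_ext dP) => [p p'|p p'|[z y''] p zp].
- exact: (gpDl gp).
- by rewrite addr0.
have [E|yy'] := pselect (y'' = y'); last first.
  exact: (gp_ne gp yy' zp (dcomp_in dQ (y', x') q)).
case: _ / E in ne *; rewrite (gp_dcomp _ _ zp).
have dA := gfree_sum (A := A) z.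
have [E|yy'] := pselect (y'' = y); last first.
  rewrite (q0 y'' p yy' (gb_col_comp zp)); exact: (dcomp0 dA).
apply: (dcomp_ne dA (qx z p (gb_row_comp zp))) => xx'.
by apply: ne; rewrite E xx'.
Qed.

(** The isomorphism is inverse to q |-> psi(-, q), and inherits its compatibilities from those of
    psi. *)
Lemma gp_graded_iso : graded_iso (gdual_comp P) (gb_comp Q).
Proof.
have [u Hu] := choice gp_dual_surj.
have dualI q q' : (forall p, psi p q = psi p q') -> q = q'.
  move=> qq'; apply/eqP; rewrite -subr_eq0; apply/eqP/gp_dual_inj => p.
  by rewrite (gpDr gp) (morphDN (psiDr p)) qq' subrr.
have uK : cancel u gp_dual by move=> f; apply: gdual_eq => p /=; apply: Hu.
have Ku : cancel gp_dual u by move=> q; apply: dualI => p; rewrite Hu.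
exists u; split.
- by exists gp_dual.
- by move=> f g; apply: dualI => p; rewrite (gpDr gp) !Hu.
- by move=> b f; apply: dualI => p; rewrite -(gpA gp) !Hu.
- by move=> f a; apply: dualI => p; rewrite (gpZr gp) !Hu.
by move=> [y x] f; rewrite gp_dual_comp uK.
Qed.

Lemma gp_fgproj_col y : fgproj (submod_of (gb_col_mod P y)).
Proof.
have [n [x [p [q [Hp _ pE _]]]]] := basis y.
have yp i : gb_col_mod P y (p i) := gb_col_comp (Hp i).
apply: (@dual_basis_fgproj _ _ n (fun i => submod_mk (yp i))
  (fun i v => psi (submod_val v) (q i))) => [i v w|i a v|v].
- exact: (gpDl gp).
- exact: (gpZl gp).
apply: val_inj; rewrite [LHS](pE _ (submod_valP v)).
rewrite [RHS](morphD_sum _ _ (@submod_valD _ _ (gb_col_mod P y))).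
by apply: eq_bigr.
Qed.

Lemma gp_fgproj_row y : fgproj (submod_of (gb_row_mod Q y)).
Proof.
have [n [x [p [q [_ Hq _ qE]]]]] := basis y.
have yq i : gb_row_mod Q y (q i) := gb_row_comp (Hq i).
apply: (@dual_basis_fgproj _ _ n (fun i => submod_mk (yq i))
  (fun i v => psi (p i) (submod_val v))) => [i v w|i a v|v].
- exact: (gpDr gp).
- exact: (gpZr gp).
apply: val_inj; rewrite [LHS](qE _ (submod_valP v)).
rewrite [RHS](morphD_sum _ _ (@submod_valD _ _ (gb_row_mod Q y))).
by apply: eq_bigr.
Qed.
End PairingTheory.

Lemma dual_bases_seq (psi : P -> Q -> A) y (T : Type) (r : seq T)
    (x : T -> X) (p : T -> P) (q : T -> Q) :
  (forall t, gb_comp P (x t, y) (p t)) -> (forall t, gb_comp Q (y, x t) (q t)) ->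
  (forall v, gb_col P y v -> v = \sum_(t <- r) psi v (q t) *: p t) ->
  (forall w, gb_row Q y w -> w = \sum_(t <- r) bmr (q t) (psi (p t) w)) ->
  dual_bases psi y.
Proof.
move=> Hp Hq pE qE; pose t := tnth (in_tuple r).
exists (size r), (x \o t), (p \o t), (q \o t); split=> [i|i|v yv|w yw] //=.
  by have := pE v yv; rewrite (big_tnth _ _ r).
by have := qE w yw; rewrite (big_tnth _ _ r).
Qed.

Section ProjectiveDual.
Hypothesis fgP : forall y, fgproj (submod_of (gb_col_mod P y)).

Let dP := gb_sum P.
Let dC := gb_col_sum P.

Lemma gb_col_dcompZ y a p : dcomp (gb_col P) y (a *: p) = a *: dcomp (gb_col P) y p.
Proof.
move: p; apply: (direct_sum_ext dC) => [p p'|p p'|z p zp].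
- by rewrite scalerDr (dcompD dC).
- by rewrite (dcompD dC) scalerDr.
have zap := gb_colZ a zp; have [<-|zy] := pselect (z = y).
  by rewrite !(dcomp_id dC).
by rewrite (dcomp_ne dC zap) // (dcomp_ne dC zp) // scaler0.
Qed.

Definition gb_col_proj y p : submod_of (gb_col_mod P y) :=
  submod_mk (U := gb_col_mod P y) (dcomp_in dC y p).

Section Extension.
Variables (y : Y) (f : submod_of (gb_col_mod P y) -> A).
Hypotheses (fD : {morph f : v w / v + w}) (fZ : forall a v, f (a *: v) = a * f v).

(** Extension by zero to the other columns; its support is at most {y}, as finiteness in the graded
    dual requires. *)
Program Definition gdual_ext : gdual P :=
  @GDual _ _ _ _ _ _ _ P (fun p => f (gb_col_proj y p)) _ _ _.
Next Obligation. by rewrite -fD; congr f; apply/val_inj/(dcompD dC). Qed.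
Next Obligation. by rewrite -fZ; congr f; apply/val_inj/gb_col_dcompZ. Qed.
Next Obligation.
apply: (sub_finite_set _ (finite_set1 y)) => z /= Hz.
apply: contrapT => zy; apply: Hz => p zp.
rewrite (_ : gb_col_proj y p = 0) ?(morphD0 fD) //.
by apply/val_inj/(dcomp_ne dC zp).
Qed.

End Extension.

(** The pairing is evaluation, transported along the inverse [w] of the isomorphism; the dual bases
    come from projectivity of the P_y. *)
Lemma gdual_iso_pairing : graded_iso (gdual_comp P) (gb_comp Q) ->
  exists2 psi, graded_pairing psi & forall y, dual_bases psi y.
Proof.
move=> [u [[w uK wK] uD uZ uR uC]].
have wD q q' : w (q + q') = w q + w q' by rewrite -[q in LHS]wK -[q' in LHS]wK -uD uK.
have wZ b q : w (b *: q) = b *: w q by rewrite -[q in LHS]wK -uZ uK.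
have wR q a : w (bmr q a) = bmr (w q) a by rewrite -[q in LHS]wK -uR uK.
have wC i q : gb_comp Q i q -> gdual_comp P i (w q) by rewrite uC wK.
pose psi p q := w q p.
have gp : graded_pairing psi.
  split; rewrite /psi.
  - by move=> p p' q; rewrite gdualD.
  - by move=> p q q'; rewrite wD.
  - by move=> a p q; rewrite gdualZ.
  - by move=> p q a; rewrite wR.
  - by move=> p b q; rewrite wZ.
  - by move=> x y z p q xyp /wC[_]; apply; apply: gb_row_comp xyp.
  - move=> x y y' z p q yy' xyp /wC[H0 _]; apply: (H0 y p yy').
    exact: gb_col_comp xyp.
exists psi => // y; have [n [e [f [fD fZ eE]]]] := fgproj_dual_basis (fgP y).
(* The dual basis (e_j, f_j) of P_y is not homogeneous; the components
   e_(j, z) of degree (z, y) and f_(j, z) of degree (y, z) still form one. *)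
pose q' j : Q := u (gdual_ext (fD j) (fZ j)).
have psi_q' p j : psi p (q' j) = f j (gb_col_proj y p) by rewrite /psi uK.
have [s us Hs] : exists2 s : seq X, uniq s &
    forall j z, z \notin s -> dcomp (gb_comp P) (z, y) (submod_val (e j)) = 0.
  have Hj j : exists s : seq (X * Y),
      forall i, i \notin s -> dcomp (gb_comp P) i (submod_val (e j)) = 0.
    exact: (dcomp_supp dP).
  have [t Ht] := choice Hj.
  exists (undup (flatten [seq map fst (t j) | j : 'I_n])); first exact: undup_uniq.
  move=> j z; rewrite mem_undup => zs; apply: Ht; apply: contra zs => zs.
  apply/flattenP; exists (map fst (t j)); last by apply/mapP; exists (z, y).
  by apply: map_f; rewrite mem_enum.
have colE v : gb_col P y v -> v = \sum_(t <- [seq (j, z) | j <- enum 'I_n, z <- s])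
    psi v (dcomp (gb_comp Q) (y, t.2) (q' t.1)) *:
    dcomp (gb_comp P) (t.2, y) (submod_val (e t.1)).
  rewrite big_allpairs_dep /= big_enum /=.
  elim=> [|[x y'] c v' /= -> xyc _ IH].
    by rewrite big1 // => j _; rewrite big1 // => z _; rewrite (gpl0 gp) scale0r.
  rewrite {1}IH; transitivity (c + \sum_(j < n) \sum_(z <- s)
      psi v' (dcomp (gb_comp Q) (y, z) (q' j)) *:
      dcomp (gb_comp P) (z, y) (submod_val (e j))) => //.
  under [RHS]eq_bigr => j _ do
    (under eq_bigr => z _ do rewrite (gpDl gp) scalerDl; rewrite big_split /=).
  rewrite big_split /=; congr (_ + _).
  have cE : c = \sum_(j < n) psi c (q' j) *: submod_val (e j).
    have := congr1 (@submod_val _ _ _) (eE (gb_col_proj y c)).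
    rewrite [LHS](dcomp_id dC (gb_col_comp xyc)) => {1}->.
    rewrite (morphD_sum _ _ (@submod_valD _ _ (gb_col_mod P y))).
    by apply: eq_bigr => j _; rewrite psi_q'.
  (* The element [c] is its own component of degree (x, y). In that degree e_(j, z) keeps only the
     part of its coefficient of degree z in A(x), which is the pairing of [c] with f_(j, z). *)
  rewrite -{1}(dcomp_id dP xyc) {1}cE (morphD_sum _ _ (dcompD dP _)).
  apply: eq_bigr => j _.
  rewrite {1}(gb_col_sum_comp (submod_valP (e j)) us (Hs j)) scaler_sumr.
  rewrite (morphD_sum _ _ (dcompD dP _)); apply: eq_bigr => z _.
  by rewrite (gb_dcompZ _ _ (dcomp_in dP (z, y) _)) -(gp_dcomp gp _ _ xyc).
apply: (dual_bases_seq (x := snd) _ _ colE) => [t|t|v yv].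
- exact: (dcomp_in dP).
- exact: (dcomp_in (gb_sum Q)).
have psiDr p : {morph psi p : q1 q2 / q1 + q2} by move=> q1 q2; apply: (gpDr gp).
(* The expansion in {}_y Q is an equality of functionals: on P_y it follows from the expansion
   [colE] of the argument, and on the other columns both sides vanish. *)
apply: (can_inj wK); apply: gdual_eq.
apply: (direct_sum_ext dC (gdualD _) (gdualD _)) => y' p y'p.
rewrite -[LHS]/(psi p v) -[RHS]/(psi p _) (morphD_sum _ _ (psiDr p)).
have [E|yy'] := pselect (y' = y); last first.
  rewrite (gp_col_row gp yy' y'p yv) big1 // => t _; rewrite (gpZr gp).
  by rewrite (gp_col_row gp yy' y'p (gb_row_comp (dcomp_in (gb_sum Q) (y, t.2) _))) mul0r.
have psiDl q : {morph psi^~ q : p1 p2 / p1 + p2} by move=> p1 p2; apply: (gpDl gp).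
rewrite E in y'p; rewrite {1}(colE p y'p) (morphD_sum _ _ (psiDl v)).
by apply: eq_bigr => t _; rewrite (gpZl gp) (gpZr gp).
Qed.
End ProjectiveDual.
End Pairings.

(** * The adjunction of a pairing with dual bases *)

Lemma gr_adjointP (k : comPzRingType) (G H : groupType) (A : galg k G) (B : galg k H)
    (X : rset G) (Y : rset H) (F : linfunctor (gr A X) (gr B Y))
    (U : linfunctor (gr B Y) (gr A X)) :
  left_adjoint F U <->
  exists (eta : forall V : grmod A X, grhom V (U (F V)))
         (eps : forall W : grmod B Y, grhom (F (U W)) W),
  [/\ forall V V' (f : grhom V V') v, eta V' (f v) = fm U (fm F f) (eta V v),
      forall W W' (g : grhom W W') w, eps W' (fm F (fm U g) w) = g (eps W w),
      forall V v, eps (F V) (fm F (eta V) v) = v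
    & forall W w, fm U (eps W) (eta (U W) w) = w].
Proof.
split=> [[eta [eps [n1 n2 t1 t2]]]|[eta [eps [n1 n2 t1 t2]]]]; exists eta, eps.
  split=> [V V' f v|W W' g w|V v|W w].
  - exact: (congr1 (fun h : grhom V (U (F V')) => h v) (n1 V V' f)).
  - exact: (congr1 (fun h : grhom (F (U W)) W' => h w) (n2 W W' g)).
  - exact: (congr1 (fun h : grhom (F V) (F V) => h v) (t1 V)).
  - exact: (congr1 (fun h : grhom (U W) (U W) => h w) (t2 W)).
split=> [V V' f|W W' g|V|W]; apply: grhom_eq => v.
- exact: n1.
- exact: n2.
- exact: t1.
- exact: t2.
Qed.

Lemma tens_mk_suml (R : pzRingType) (M : lmodType R^c) (N : lmodType R) (T : Type)
    (r : seq T) (m : T -> M) (n : N) :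
  (\sum_(t <- r) m t) \ot n = \sum_(t <- r) m t \ot n.
Proof. exact: (morphD_sum r m (fun u v => tens_mkDl u v n)). Qed.

Lemma tens_mk_sumr (R : pzRingType) (M : lmodType R^c) (N : lmodType R) (T : Type)
    (r : seq T) (m : M) (n : T -> N) :
  m \ot (\sum_(t <- r) n t) = \sum_(t <- r) m \ot n t.
Proof. exact: (morphD_sum r n (tens_mkDr m)). Qed.

Section CompletedTensorValues.
Context {k : comPzRingType} {G H : groupType} {A : galg k G} {B : galg k H}.
Context {X : rset G} {Y : rset H} {P : grbimod A B X Y} {M : grmod A X}.

Definition cval (t : ctens P M) : tens M P := submod_val (t : submod_of _).

Lemma cval_inj : injective cval. Proof. exact: val_inj. Qed.

Lemma cvalD : {morph cval : s t / s + t}. Proof. by []. Qed.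

Lemma cvalZ (t : ctens P M) (b : B) : cval (t :* b) = (cval t : rtens M P) :* b.
Proof. by []. Qed.

Lemma cval_cmk x y m p : gm_comp M x m -> gb_comp P (x, y) p ->
  cval (cmk m p) = m \ot p.
Proof. by move=> xm xyp; apply: cmk_val xm (gb_row_comp xyp). Qed.

End CompletedTensorValues.

Section PairingAdjunction.
Context {k : comPzRingType} {G H : groupType} {A : galg k G} {B : galg k H}.
Context {X : rset G} {Y : rset H} {P : grbimod A B X Y} {Q : grbimod B A Y X}.
Context {psi : P -> Q -> A} (gp : graded_pairing psi).

Section Counit.
Variable W : grmod A X.

Fact pair_act_balanced q : balanced (fun (w : W) (p : P) => w :* psi p q).
Proof.
split=> [w w' p|w p p'|w a p].
- exact: rscaleDl.
- by rewrite (gpDl gp) rscaleDr.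
- by rewrite (gpZl gp) rscaleM.
Qed.

(** The counit w \ot p \ot q |-> w psi(p, q) is built by two successive lifts; this is the first,
    with q fixed. *)
Definition pair_act (t : ctens P W) (q : Q) : W :=
  tens_lift (fun w p => w :* psi p q) (cval t).

Lemma pair_actDl q : {morph pair_act^~ q : t u / t + u}.
Proof. by move=> t u; apply: (tens_liftD (pair_act_balanced q)). Qed.

Lemma pair_act_cmk x y w p q : gm_comp W x w -> gb_comp P (x, y) p ->
  pair_act (cmk w p) q = w :* psi p q.
Proof.
move=> xw xyp; rewrite /pair_act (cval_cmk xw xyp).
exact: (tens_liftE (pair_act_balanced q)).
Qed.

Fact pair_act_bal : balanced (fun (t : ctens P W) (q : Q) => pair_act t q).
Proof.
split=> [t u q|t q q'|t b q]; first exact: pair_actDl.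
  move: t; apply: ctens_ext => [t u|t u|x y w p xw xyp].
  - exact: pair_actDl.
  - by rewrite !pair_actDl addrACA.
  - by rewrite !(pair_act_cmk _ xw xyp) (gpDr gp) rscaleDr.
rewrite /pair_act cvalZ; move: (cval t).
apply: tens_ext => [||u v|u v|w p].
- by rewrite rscale0l; apply: (tens_lift0 (pair_act_balanced q)).
- exact: (tens_lift0 (pair_act_balanced _)).
- rewrite [X in tens_lift _ X](@rscaleDl _ (rtens W P)).
  exact: (tens_liftD (pair_act_balanced _)).
- exact: (tens_liftD (pair_act_balanced _)).
rewrite rtens_rscaleE !(tens_liftE (pair_act_balanced _)).
by rewrite (gpA gp).
Qed.

Definition pair_eps_fun (s : ctens Q (ctens P W)) : W := tens_lift pair_act (cval s).

Lemma pair_epsD : {morph pair_eps_fun : s t / s + t}.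
Proof. by move=> s t; apply: (tens_liftD pair_act_bal). Qed.

Lemma pair_eps_cmk y x t q : gm_comp (ctens P W) y t -> gb_comp Q (y, x) q ->
  pair_eps_fun (cmk t q) = pair_act t q.
Proof.
by move=> yt yxq; rewrite /pair_eps_fun (cval_cmk yt yxq) (tens_liftE pair_act_bal).
Qed.

Lemma pair_actZ t q a : pair_act t (bmr q a) = pair_act t q :* a.
Proof.
move: t; apply: ctens_ext => [t u|t u|x y w p xw xyp].
- exact: pair_actDl.
- by rewrite pair_actDl rscaleDl.
- by rewrite !(pair_act_cmk _ xw xyp) (gpZr gp) rscaleM.
Qed.

Lemma pair_epsZ s a : pair_eps_fun (s :* a) = pair_eps_fun s :* a.
Proof.
rewrite /pair_eps_fun cvalZ; move: (cval s).
apply: tens_ext => [||u v|u v|t q].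
- by rewrite rscale0l; apply: (tens_lift0 pair_act_bal).
- by rewrite (tens_lift0 pair_act_bal) rscale0l.
- rewrite [X in tens_lift _ X](@rscaleDl _ (rtens (ctens P W) Q)).
  exact: (tens_liftD pair_act_bal).
- by rewrite (tens_liftD pair_act_bal) rscaleDl.
by rewrite rtens_rscaleE !(tens_liftE pair_act_bal) pair_actZ.
Qed.

Lemma pair_act_deg y x t q : gm_comp (ctens P W) y t -> gb_comp Q (y, x) q ->
  gm_comp W x (pair_act t q).
Proof.
have sW := comp_subgroup (gm_sum W) x => yt yxq; move: t yt.
apply: ctens_comp_ind => [|z w p t zw zyp IH].
  by rewrite (morphD0 (pair_actDl q)); exact: sW.1.
rewrite pair_actDl (pair_act_cmk _ zw zyp); apply: subgroupD => //.
by apply: rscale_isum zw (gp_deg gp zyp yxq).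
Qed.

Lemma pair_eps_deg x s : gm_comp (ctens Q (ctens P W)) x s -> gm_comp W x (pair_eps_fun s).
Proof.
have sW := comp_subgroup (gm_sum W) x; move: s.
apply: ctens_comp_ind => [|y t q s yt yxq IH].
  by rewrite (morphD0 pair_epsD); exact: sW.1.
rewrite pair_epsD (pair_eps_cmk yt yxq); apply: subgroupD => //.
exact: pair_act_deg yxq.
Qed.

Definition pair_eps : grhom (ctens Q (ctens P W)) W :=
  GrHom pair_epsD pair_epsZ pair_eps_deg.

Lemma pair_epsE y x t q : gm_comp (ctens P W) y t -> gb_comp Q (y, x) q ->
  pair_eps (cmk t q) = pair_act t q.
Proof. exact: pair_eps_cmk. Qed.

End Counit.

Hypothesis basis : forall y, dual_bases psi y.

Lemma cmk_basis (V : grmod B Y) y n (x : 'I_n -> X) (p : 'I_n -> P) (q : 'I_n -> Q)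
    (v : V) z s :
  (forall i, gb_comp Q (y, x i) (q i)) ->
  (forall s, gb_row Q y s -> s = \sum_(i < n) bmr (q i) (psi (p i) s)) ->
  gm_comp V y v -> gb_comp Q (y, z) s ->
  cmk v s = \sum_(i < n) cmk v (q i) :* psi (p i) s :> ctens Q V.
Proof.
move=> Hq qE yv yzs; apply: cval_inj.
rewrite (cval_cmk yv yzs) {1}(qE _ (gb_row_comp yzs)) tens_mk_sumr (morphD_sum _ _ cvalD).
by apply: eq_bigr => i _; rewrite cvalZ (cval_cmk yv (Hq i)) rtens_rscaleE.
Qed.

(* Independence of sum_i v \ot q_i \ot p_i of the dual bases, for b = 1. *)
Lemma cmk_bases_change (V : grmod B Y) y h y' v b n (x : 'I_n -> X) (p : 'I_n -> P)
    (q : 'I_n -> Q) n' (x' : 'I_n' -> X) (p' : 'I_n' -> P) (q' : 'I_n' -> Q) :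
  ract y h = y' ->
  (forall i, gb_comp P (x i, y) (p i)) -> (forall i, gb_comp Q (y, x i) (q i)) ->
  (forall s, gb_row Q y s -> s = \sum_(i < n) bmr (q i) (psi (p i) s)) ->
  (forall j, gb_comp P (x' j, y') (p' j)) -> (forall j, gb_comp Q (y', x' j) (q' j)) ->
  (forall r, gb_col P y' r -> r = \sum_(j < n') psi r (q' j) *: p' j) ->
  gm_comp V y v -> gcomp B h b ->
  \sum_(j < n') cmk (cmk (v :* b) (q' j)) (p' j) =
  (\sum_(i < n) cmk (cmk v (q i)) (p i)) :* b :> ctens P (ctens Q V).
Proof.
move=> yh Hp Hq qE Hp' Hq' pE' yv hb; apply: cval_inj.
have yhvb := gm_deg yv hb; rewrite yh in yhvb.
rewrite cvalZ !(morphD_sum _ _ cvalD).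
rewrite [RHS](@morphD_sum (rtens (ctens Q V) P) (rtens (ctens Q V) P)
  (fun t => t :* b)); last first.
  by move=> s t; apply: rscaleDl.
(* Both sides reduce to one double sum: on the left b q'_j is expanded in the q_i, on the right p_i
   b is expanded in the p'_j. *)
transitivity (\sum_(j < n') \sum_(i < n)
    (cmk v (q i) : ctens Q V) \ot (psi (bmr (p i) b) (q' j) *: p' j)).
  apply: eq_bigr => j _; have vbq := cmk_comp yhvb (Hq' j).
  rewrite (cval_cmk vbq (Hp' j)).
  have bq : gb_comp Q (y, x' j) (b *: q' j).
    have := gb_degl hb (Hq' j).
    by rewrite /lact -yh -ractM mulgV ract1.
  have -> : cmk (v :* b) (q' j) = cmk v (b *: q' j) :> ctens Q V.
    by apply: cval_inj; rewrite (cval_cmk yhvb (Hq' j)) (cval_cmk yv bq) tens_mkA.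
  rewrite (cmk_basis Hq qE yv bq) tens_mk_suml; apply: eq_bigr => i _.
  by rewrite tens_mkA (gpA gp).
rewrite exchange_big; apply: eq_bigr => i _ /=.
rewrite -tens_mk_sumr (cval_cmk (cmk_comp yv (Hq i)) (Hp i)) rtens_rscaleE.
by rewrite -pE' // -yh; apply: gb_col_comp (gb_degr (Hp i) hb).
Qed.

(** Dual bases are chosen separately for each y, and the unit is assembled degree by degree. For b
    of degree h, linearity compares the bases at y and at yh. The bases are returned with the unit
    for later computations. *)
Lemma pair_eta_exists (V : grmod B Y) : exists eta : grhom V (ctens P (ctens Q V)),
  forall y, exists n (x : 'I_n -> X) (p : 'I_n -> P) (q : 'I_n -> Q),
  [/\ forall i, gb_comp P (x i, y) (p i), forall i, gb_comp Q (y, x i) (q i),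
      forall r, gb_col P y r -> r = \sum_(i < n) psi r (q i) *: p i,
      forall s, gb_row Q y s -> s = \sum_(i < n) bmr (q i) (psi (p i) s)
    & forall v, gm_comp V y v -> eta v = \sum_(i < n) cmk (cmk v (q i)) (p i)].
Proof.
have dV := gm_sum V.
have He y : exists e : V -> ctens P (ctens Q V),
    exists n (x : 'I_n -> X) (p : 'I_n -> P) (q : 'I_n -> Q),
    [/\ forall i, gb_comp P (x i, y) (p i), forall i, gb_comp Q (y, x i) (q i),
        forall r, gb_col P y r -> r = \sum_(i < n) psi r (q i) *: p i,
        forall s, gb_row Q y s -> s = \sum_(i < n) bmr (q i) (psi (p i) s)
      & forall v, e v = \sum_(i < n) cmk (cmk (dcomp (gm_comp V) y v) (q i)) (p i)].
  have [n [x [p [q [Hp Hq pE qE]]]]] := basis y.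
  by exists (fun v => \sum_(i < n) cmk (cmk (dcomp (gm_comp V) y v) (q i)) (p i));
    exists n, x, p, q.
have {He}[e He] := choice He.
have eD y : {morph e y : u v / u + v}.
  have [n [x [p [q [Hp Hq _ _ eE]]]]] := He y; move=> u v.
  rewrite !eE -big_split /=; apply: eq_bigr => i _; rewrite (dcompD dV).
  have uy := dcomp_in dV y u; have vy := dcomp_in dV y v.
  rewrite (cmk_add uy vy (gb_row_comp (Hq i))).
  by rewrite (cmk_add _ _ (gb_row_comp (Hp i))) //; apply: cmk_comp (Hq i).
have e0 y v : dcomp (gm_comp V) y v = 0 -> e y v = 0.
  have [n [x [p [q [_ _ _ _ eE]]]]] := He y => v0.
  by rewrite eE v0 -(dcomp0 dV y) -eE (morphD0 (eD y)).
have efin v : fin_supp (e^~ v).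
  by have [s Hs] := dcomp_supp dV v; exists s => y /Hs; apply: e0.
pose eta v := fsum (e^~ v).
have etaD : {morph eta : u v / u + v}.
  move=> u v; rewrite /eta -fsumD; try exact: efin.
  by apply: eq_fsum => y; rewrite eD.
have etaE y v : gm_comp V y v -> eta v = e y v.
  by move=> yv; apply: fsum1 => z zy; apply: e0; apply: (dcomp_ne dV yv) => /esym.
have eta_deg y v : gm_comp V y v -> gm_comp (ctens P (ctens Q V)) y (eta v).
  move=> yv; rewrite (etaE y v yv); have [n [x [p [q [Hp Hq _ _ ->]]]]] := He y.
  apply: (comp_sum (gm_sum _)) => i; apply: cmk_comp (Hp i).
  exact: cmk_comp (dcomp_in dV y v) (Hq i).
have etaZ v (b : B) : eta (v :* b) = eta v :* b.
  move: v; apply: (direct_sum_ext dV) => [u v|u v|y v yv].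
  - by rewrite rscaleDl etaD.
  - by rewrite etaD rscaleDl.
  move: b; apply: (direct_sum_ext (gcomp_sum B)) => [b c|b c|h b hb].
  - by rewrite rscaleDr etaD.
  - by rewrite rscaleDr.
  have yhvb := gm_deg yv hb; rewrite (etaE _ _ yhvb) (etaE _ _ yv).
  have [n [x [p [q [Hp Hq pE qE ->]]]]] := He y.
  have [n' [x' [p' [q' [Hp' Hq' pE' qE' ->]]]]] := He (ract y h).
  rewrite (dcomp_id dV yhvb) (dcomp_id dV yv).
  exact: (cmk_bases_change erefl Hp Hq qE Hp' Hq' pE' yv hb).
exists (GrHom etaD etaZ eta_deg) => y /=.
have [n [x [p [q [Hp Hq pE qE eE]]]]] := He y; exists n, x, p, q; split=> // v yv.
by rewrite (etaE y v yv) eE (dcomp_id dV).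
Qed.

Lemma pairing_adjoint : left_adjoint (ctens_functor Q) (ctens_functor P).
Proof.
have eta_ex (V : grmod B Y) := pair_eta_exists V.
pose eta V := projT1 (cid (eta_ex V)).
have etaP V := projT2 (cid (eta_ex V)); rewrite -/(eta _) in etaP.
apply/gr_adjointP; exists eta, pair_eps; split=> [V V' f|W W' g|V|W].
- apply: (direct_sum_ext (gm_sum V)) => [u v|u v|y v yv]; rewrite ?grhomD //.
  have [n [x [p [q [Hp Hq pE qE eE]]]]] := etaP V y.
  have [n' [x' [p' [q' [Hp' Hq' pE' qE' eE']]]]] := etaP V' y.
  have yfv := grhom_deg f yv.
  (* The bases chosen for V and V' may differ; the change of bases is applied with b = 1. *)
  rewrite (eE v yv) (eE' _ yfv) -[f v]rscale1.
  rewrite (cmk_bases_change (ract1 y) Hp Hq qE Hp' Hq' pE' yfv (gcomp1 B)) rscale1.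
  rewrite (morphD_sum _ _ (grhomD _)); apply: eq_bigr => i _.
  rewrite [RHS](ctens_map_cmk _ (cmk_comp yv (Hq i)) (gb_row_comp (Hp i))).
  by congr (cmk _ _); apply/esym/(ctens_map_cmk _ yv (gb_row_comp (Hq i))).
- apply: ctens_ext => [s t|s t|y x t q yt yxq]; rewrite ?grhomD //.
  rewrite [fm _ _ _](ctens_map_cmk _ yt (gb_row_comp yxq)).
  have ygt := grhom_deg (ctens_map P g) yt.
  rewrite [LHS](pair_eps_cmk ygt yxq) (pair_epsE yt yxq).
  move: t {yt ygt}; apply: ctens_ext => [s t|s t|z y' w p zw zyp].
  - by rewrite grhomD; apply: pair_actDl.
  - by rewrite pair_actDl grhomD.
  rewrite (ctens_map_cmk _ zw (gb_row_comp zyp)) (pair_act_cmk _ zw zyp).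
  by rewrite (pair_act_cmk _ (grhom_deg g zw) zyp) grhomZ.
- apply: ctens_ext => [s t|s t|y x v q yv yxq]; rewrite ?grhomD //.
  have [n [x' [p' [q' [Hp Hq pE qE eE]]]]] := etaP V y.
  rewrite [fm _ _ _](ctens_map_cmk _ yv (gb_row_comp yxq)).
  rewrite [LHS](pair_eps_cmk (grhom_deg (eta V) yv) yxq) (eE v yv).
  (* This triangle identity is the expansion of [q] in the dual basis of {}_y Q. *)
  rewrite (morphD_sum _ _ (pair_actDl q)) (cmk_basis Hq qE yv yxq).
  by apply: eq_bigr => i _; apply: (pair_act_cmk _ (cmk_comp yv (Hq i)) (Hp i)).
apply: ctens_ext => [s t|s t|x y w p xw xyp]; rewrite ?grhomD //.
have ywp := cmk_comp xw xyp.
have [n [x' [p' [q' [Hp Hq pE qE eE]]]]] := etaP (ctens P W) y.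
rewrite (eE _ ywp) (morphD_sum _ _ (grhomD _)); apply: cval_inj.
(* The second triangle identity is the expansion of [p] in the dual basis of P_y. *)
rewrite (morphD_sum _ _ cvalD) (cval_cmk xw xyp) {2}(pE p (gb_col_comp xyp)) tens_mk_sumr.
apply: eq_bigr => i _; have wq := cmk_comp ywp (Hq i).
rewrite [fm _ _ _](ctens_map_cmk _ wq (gb_row_comp (Hp i))).
have E : pair_eps W (cmk (cmk w p) (q' i)) = w :* psi p (q' i).
  by rewrite [LHS](pair_eps_cmk ywp (Hq i)) (pair_act_cmk _ xw xyp).
rewrite E (cval_cmk _ (Hp i)) ?tens_mkA //.
exact: rscale_isum xw (gp_deg gp xyp (Hq i)).
Qed.
End PairingAdjunction.

(** * The Eilenberg-Watts transformation *)

Section WattsTransformation.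
Context {k : comPzRingType} {G H : groupType} {A : galg k G} {B : galg k H}.
Context {X : rset G} {Y : rset H} (F : linfunctor (gr A X) (gr B Y)).

Section Objects.
Variable W : grmod A X.

Fact wpair_bal : balanced (fun (w : W) (m : watts F) => wpair w m).
Proof.
split=> [v w m|w m n|w a m]; [exact: wpairDl|exact: wpairDr|].
exact: wpair_balanced.
Qed.

Definition wnat_fun (t : ctens (watts F) W) : F W :=
  tens_lift (fun (w : W) (m : watts F) => wpair w m) (cval t).

Lemma wnatD : {morph wnat_fun : s t / s + t}.
Proof. by move=> s t; apply: (tens_liftD wpair_bal). Qed.

Lemma wnat_cmk x (w : W) (m : watts F) : gm_comp W x w -> gb_row (watts F) x m ->
  wnat_fun (cmk w m) = wpair w m.
Proof.
by move=> xw xm; rewrite /wnat_fun /cval (cmk_val xw xm) (tens_liftE wpair_bal).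
Qed.

Lemma wnatZ (t : ctens (watts F) W) (b : B) : wnat_fun (t :* b) = wnat_fun t :* b.
Proof.
rewrite /wnat_fun cvalZ; move: (cval t).
apply: tens_ext => [||u v|u v|w m].
- by rewrite rscale0l; apply: (tens_lift0 wpair_bal).
- by rewrite (tens_lift0 wpair_bal) rscale0l.
- rewrite [X in tens_lift _ X](@rscaleDl _ (rtens W (watts F))).
  exact: (tens_liftD wpair_bal).
- by rewrite (tens_liftD wpair_bal) rscaleDl.
by rewrite rtens_rscaleE !(tens_liftE wpair_bal); apply: wpair_wmr.
Qed.

Lemma wnat_deg y (t : ctens (watts F) W) :
  gm_comp (ctens (watts F) W) y t -> gm_comp (F W) y (wnat_fun t).
Proof.
have sF := comp_subgroup (gm_sum (F W)) y; move: t.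
apply: ctens_comp_ind => [|x w m t xw xym IH].
  by rewrite (morphD0 wnatD); exact: sF.1.
rewrite wnatD (wnat_cmk xw (gb_row_comp xym)); apply: subgroupD => //.
by rewrite (wpair_hom _ xw); apply: grhom_deg; case: xym.
Qed.

Definition wnat : grhom (ctens (watts F) W) (F W) := GrHom wnatD wnatZ wnat_deg.

Lemma wnatE x (w : W) (m : watts F) : gm_comp W x w -> gb_row (watts F) x m ->
  wnat (cmk w m) = wpair w m.
Proof. exact: wnat_cmk. Qed.

Lemma xinj_row x (s : F (gfree A x)) :
  gb_row (watts F) x (xinj (V := fun x => F (gfree A x)) s).
Proof.
elim/(direct_sum_ind (gm_sum (F (gfree A x)))): s => [|y c s yc IH].
  by rewrite xinj0; apply: isum0.
rewrite xinjD; apply: isumD IH; apply: (isum_elt (i := (x, y))) => //.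
exact: xinj_wcomp.
Qed.

(* A morphism q out of F(W) that kills the image of [wnat] kills F(hat x w)
   for all x and w, so its adjunct kills W. *)
Lemma wnat_surj (U : linfunctor (gr B Y) (gr A X)) : left_adjoint F U ->
  forall v, exists t, wnat t = v.
Proof.
move=> /gr_adjointP[eta [eps [etan epsn tF _]]].
pose q := gcoker_proj wnat.
have q_hat x w s : q (fm F (hat x w) s) = 0.
  apply/gcoker_projE.
  exists (cmk (dcomp (gm_comp W) x w) (xinj (V := fun x => F (gfree A x)) s : watts F)).
  by rewrite (wnatE (dcomp_in (gm_sum W) x w) (xinj_row s)) wpair_inj hat_dcomp.
have qt : grhom_comp (fm U q) (eta W) = 0.
  apply: grhom_eq; apply: (direct_sum_ext (gm_sum W)) => [v w|v w|x w xw].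
  - exact: grhomD.
  - exact: grhomD.
  have <- : hat x w (gfree_one A x) = w by rewrite hat1 (dcomp_id (gm_sum W)).
  rewrite -[LHS]/(fm U q (eta W (hat x w (gfree_one A x)))) etan.
  rewrite -fm_comp (_ : grhom_comp q _ = 0) ?fm0 //.
  exact/grhom_eq/q_hat.
have q0 v : q v = 0.
  (* By a triangle identity and naturality, [q] is [eps] composed with F of its adjunct, which is
     zero. *)
  by rewrite -[v]tF -epsn -fm_comp qt fm0 grhom0.
by move=> v; apply/gcoker_projE/q0.
Qed.

End Objects.

Lemma wnat_natural V W (f : grhom V W) t :
  wnat W (ctens_map (watts F) f t) = fm F f (wnat V t).
Proof.
move: t; apply: ctens_ext => [s t|s t|x y v m xv xym]; rewrite ?grhomD //.
have xm := gb_row_comp xym.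
by rewrite (ctens_map_cmk _ xv xm) (wnatE xv xm) (wnatE (grhom_deg f xv) xm) wpair_nat.
Qed.

End WattsTransformation.

(** * The pairing between the bimodules of two adjoint functors *)

Section WattsPairing.
Context {k : comPzRingType} {G H : groupType} {A : galg k G} {B : galg k H}.
Context {X : rset G} {Y : rset H}.
Context (S : linfunctor (gr A X) (gr B Y)) (T : linfunctor (gr B Y) (gr A X)).
Variables (eta : forall V : grmod B Y, grhom V (S (T V)))
          (eps : forall W : grmod A X, grhom (T (S W)) W).
Hypotheses
  (etan : forall V V' (f : grhom V V') v, eta V' (f v) = fm S (fm T f) (eta V v))
  (epsn : forall W W' (g : grhom W W') w, eps W' (fm T (fm S g) w) = g (eps W w))
  (epsT : forall V v, eps (T V) (fm T (eta V) v) = v)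
  (etaS : forall W w, fm S (eps W) (eta (S W) w) = w).

Implicit Types (m : watts S) (n : watts T).

Let ev x m n : A := eps (gfree A x) (wpair (m x : S (gfree A x)) n).

(* For m in S(A(x)) of degree y, corresponding to m^ : B(y) -> S(A(x)), and
   n in T(B(y)), this is eps (T(m^) n). *)
Definition wpsi m n : A := fsum (fun x => ev x m n).

Let ev_fin m n : fin_supp (fun x => ev x m n).
Proof.
case: (xs_fin m) => s Hs; exists s => x /Hs E.
by rewrite /ev E (morphD0 (fun v w => wpairDl v w n)) grhom0.
Qed.

Let evDl x n : {morph (fun m => ev x m n) : m m' / m + m'}.
Proof. by move=> m m'; rewrite /ev xsE_D wpairDl grhomD. Qed.

Lemma wpsiDl n : {morph wpsi^~ n : m m' / m + m'}.
Proof.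
move=> m m'; rewrite /wpsi -fsumD; try exact: ev_fin.
by apply: eq_fsum => x; apply: evDl.
Qed.

Lemma wpsi_supp x m n : (forall z, z <> x -> m z = 0) ->
  wpsi m n = eps (gfree A x) (wpair (m x : S (gfree A x)) n).
Proof.
move=> m0; apply: fsum1 => z zx.
by rewrite /ev m0 // (morphD0 (fun v w => wpairDl v w n)) grhom0.
Qed.

Lemma wpsi_comp x y m n : gb_comp (watts S) (x, y) m ->
  wpsi m n = eps (gfree A x) (fm T (hat y (m x : S (gfree A x))) (n y)).
Proof. by move=> [m0 ym]; rewrite (wpsi_supp n m0) (wpair_hom _ ym). Qed.

Lemma wpsi_pairing : graded_pairing wpsi.
Proof.
split.
- by move=> m m' n; apply: wpsiDl.
- move=> m n n'; rewrite /wpsi -fsumD; try exact: ev_fin.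
  by apply: eq_fsum => x; rewrite /ev wpairDr grhomD.
- move=> a m n; move: m; apply: xsum_ind => [|x s m IH].
    by rewrite scaler0 (morphD0 (wpsiDl n)) mulr0.
  rewrite scalerDr [LHS]wpsiDl IH [in RHS]wpsiDl mulrDr; congr (_ + _).
  move: a {IH}; apply: (direct_sum_ext (gcomp_sum A)) => [a b|a b|g a ga].
  + by rewrite scalerDl; apply: wpsiDl.
  + exact: mulrDl.
  (* For [a] of degree g, the product with an element supported at x is supported at xg^-1, where
     left linearity becomes naturality of [wpair] and [eps]. *)
  have E z : (a *: (xinj s : watts S) : wmod S) z = fm S (hat x (a : gfree A z)) s.
    exact: wpair_inj.
  rewrite [in RHS](@wpsi_supp x) => [|z zx]; last exact: xinj_out.
  set z := lact g x; have zg : ract z g = x by rewrite /z /lact -ractM mulVg ract1.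
  have xa : gm_comp (gfree A z) x a by apply: isum_elt ga.
  rewrite (@wpsi_supp z) => [|z' zz'].
    rewrite [X in wpair X n](E z) xinj_in.
    by rewrite wpair_nat epsn hatE (dcomp_id (gm_sum _) xa).
  rewrite [LHS](E z').
  have z'a : gm_comp (gfree A z') (ract z' g) a by apply: isum_elt ga.
  rewrite hat_eq0 ?fm0 //; apply: (dcomp_ne (gm_sum _) z'a) => z'g; apply: zz'.
  by rewrite /z -z'g /lact -ractM mulgV ract1.
- move=> m n a; rewrite /wpsi (fsum_morph (f := fun c => c * a)); last exact: ev_fin.
    by apply: eq_fsum => x; rewrite /ev [wpair _ _]wpair_wmr grhomZ.
  by move=> c d; apply: mulrDl.
- by move=> m b n; apply: eq_fsum => x; rewrite /ev [wpair _ n]wpair_balanced.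
- move=> x y z m n xym [_ yzn]; rewrite (wpsi_comp n xym).
  exact: (grhom_deg (eps (gfree A x)) (grhom_deg (fm T (hat y (m x))) yzn)).
move=> x y y' z m n yy' xym [n0 _].
by rewrite (wpsi_comp n xym) n0 // !grhom0.
Qed.

Hypothesis wS : forall W v, exists t, wnat S W t = v.

(** Surjectivity of [wnat] at T(B(y)) gives the unit element a preimage of its own degree y, which
    is a finite sum of homogeneous tensors. *)
Lemma unit_decomp y : exists (d : nat) (x : 'I_d -> X) (w : 'I_d -> T (gfree B y))
    (p : 'I_d -> watts S),
  [/\ forall i, gm_comp (T (gfree B y)) (x i) (w i),
      forall i, gb_comp (watts S) (x i, y) (p i)
    & \sum_(i < d) wpair (w i) (p i) = eta (gfree B y) (gfree_one B y)].
Proof.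
have ye : gm_comp (S (T (gfree B y))) y (eta (gfree B y) (gfree_one B y)).
  exact/grhom_deg/gfree1.
have [t yt et] := grhom_surj_deg (wS (W := T (gfree B y))) ye.
rewrite -et => {ye et}; move: t yt.
apply: ctens_comp_ind => [|x w p t xw xyp [d [x' [w' [p' [Hw Hp Ep]]]]]].
  (* X may be empty, so the empty family of degrees is defined by case analysis. *)
  have x0 : 'I_0 -> X by case.
  exists 0, x0, (fun=> 0), (fun=> 0); split=> [[] //|[] //|].
  by rewrite grhom0 big_ord0.
rewrite grhomD (wnatE xw (gb_row_comp xyp)) -Ep.
exists d.+1, (fun i => oapp x' x (unlift ord0 i)), (fun i => oapp w' w (unlift ord0 i)).
exists (fun i => oapp p' p (unlift ord0 i)); split=> [i|i|].
- by case: unliftP => [j|] _ //=; apply: Hw.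
- by case: unliftP => [j|] _ //=; apply: Hp.
rewrite big_ord_recl unlift_none; congr (_ + _); apply: eq_bigr => i _.
by rewrite liftK.
Qed.

Let tinj y (w : T (gfree B y)) : watts T := xinj (V := fun y => T (gfree B y)) w.

Let wpsi_tinj x y m w : gb_comp (watts S) (x, y) m ->
  wpsi m (tinj w) = eps (gfree A x) (fm T (hat y (m x : S (gfree A x))) w).
Proof. by move=> xym; rewrite (wpsi_comp _ xym) /tinj xinj_in. Qed.

(** Let c have degree (z, y), and let c^ : B(y) -> S(A(z)) be its morphism. The triangle identity
    for S and naturality of eta write c_z as S(eps) S(T(c^)) applied to eta(1_y). Substituting the
    decomposition of eta(1_y) gives the coefficients eps(T(c^) w_i). *)
Lemma unit_col y (d : nat) (x : 'I_d -> X) (w : 'I_d -> T (gfree B y))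
    (p : 'I_d -> watts S) :
  (forall i, gm_comp (T (gfree B y)) (x i) (w i)) ->
  (forall i, gb_comp (watts S) (x i, y) (p i)) ->
  \sum_(i < d) wpair (w i) (p i) = eta (gfree B y) (gfree_one B y) ->
  forall m, gb_col (watts S) y m -> m = \sum_(i < d) wpsi m (tinj (w i)) *: p i.
Proof.
move=> Hw Hp etaE m; elim=> [|[z y'] c v /= -> zyc _ IH].
  by rewrite big1 // => i _; rewrite (morphD0 (wpsiDl _)) scale0r.
under eq_bigr => i _ do rewrite wpsiDl scalerDl.
rewrite big_split /= -IH; congr (_ + _) => {v IH}.
(* Every term has degree (z, y), so only the coordinate at z has content. *)
have zyP i : gb_comp (watts S) (z, y) (wpsi c (tinj (w i)) *: p i).
  have yzw : gb_comp (watts T) (y, x i) (tinj (w i)) by apply: xinj_wcomp.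
  have := gp_deg wpsi_pairing zyc yzw.
  have sM := comp_subgroup (gb_sum (watts S)) (z, y).
  elim=> [|g a a' /= zg ga _ IH]; first by rewrite scale0r; exact: sM.1.
  rewrite scalerDl; apply: subgroupD => //; have := gb_degl ga (Hp i).
  by rewrite -zg /lact -ractM mulgV ract1.
have [c0 yc] := zyc; apply: xsum_eq => z'.
have xsD u : {morph (fun m => m u) : m m' / m + m'} by [].
rewrite [RHS](morphD_sum _ _ (xsD z')).
have [E|/eqP zz'] := eqVneq z' z; last first.
  by rewrite c0 // big1 // => i _; have [ap0 _] := zyP i; apply: ap0.
rewrite {z' xsD}E; pose e : S (gfree A z) := c z.
transitivity (fm S (eps (gfree A z))
  (fm S (fm T (hat y e)) (eta (gfree B y) (gfree_one B y)))).
  by rewrite -etan hat1 (dcomp_id (gm_sum _) yc) etaS.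
rewrite -etaE !(morphD_sum _ _ (grhomD _)); apply: eq_bigr => i _.
by rewrite -!wpair_nat -(wpsi_tinj _ zyc).
Qed.

(** The other triangle identity: n_y = eps(T(eta) n_y), where by Yoneda eta is the morphism of
    eta(1_y), hence the sum of those of the S(w_i^)(p_i). Naturality of eps moves w_i^ outside. *)
Lemma unit_row y (d : nat) (x : 'I_d -> X) (w : 'I_d -> T (gfree B y))
    (p : 'I_d -> watts S) :
  (forall i, gm_comp (T (gfree B y)) (x i) (w i)) ->
  (forall i, gb_comp (watts S) (x i, y) (p i)) ->
  \sum_(i < d) wpair (w i) (p i) = eta (gfree B y) (gfree_one B y) ->
  forall n, gb_row (watts T) y n -> n = \sum_(i < d) bmr (tinj (w i)) (wpsi (p i) n).
Proof.
move=> Hw Hp etaE n yn.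
have n0 z : z <> y -> n z = 0.
  move=> zy; elim: yn => [//|[y' x'] c v /= -> [c0 _] _ IH].
  by rewrite -[LHS]/((c : wmod T) z + (v : wmod T) z) IH addr0 c0.
have xsD u : {morph (fun n => n u) : n n' / n + n'} by [].
apply: xsum_eq => z; rewrite [RHS](morphD_sum _ _ (xsD z)).
have [E|/eqP zy] := eqVneq z y; last first.
  rewrite n0 // big1 // => i _; rewrite -[LHS]/(tinj (w i) z :* _).
  by rewrite /tinj xinj_out // rscale0l.
rewrite {z xsD}E -[LHS](epsT (n y : T (gfree B y))).
rewrite -[X in fm T X]hat_yoneda -etaE.
transitivity (\sum_(i < d) eps (T (gfree B y)) (fm T (hat y (wpair (w i) (p i))) (n y))).
  have hD : {morph (fun s => eps (T (gfree B y)) (fm T (hat y s) (n y))) : s t / s + t}.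
    by move=> s t; rewrite hat_add fmD grhomD.
  exact: (morphD_sum _ _ hD).
apply: eq_bigr => i _; rewrite -[RHS]/(tinj (w i) y :* _) /tinj xinj_in.
rewrite (wpair_hom _ (Hw i)) -hat_comp fm_comp epsn hatE (dcomp_id (gm_sum _) (Hw i)).
by rewrite (wpsi_comp _ (Hp i)).
Qed.

Lemma wpsi_bases y : dual_bases wpsi y.
Proof.
have [d [x [w [p [Hw Hp Ew]]]]] := unit_decomp y.
exists d, x, p, (fun i => tinj (w i)); split=> //.
- by move=> i; apply: xinj_wcomp.
- exact: unit_col Hw Hp Ew.
exact: unit_row Hw Hp Ew.
Qed.

(* In degree y an inverse is s |-> sum_i eps (T(s^) w_i) \ot p_i. *)
Lemma wnat_inj W t : wnat S W t = 0 -> t = 0.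
Proof.
move=> t0; apply: (dcomp_inj (gm_sum (ctens (watts S) W))) => y.
rewrite (dcomp0 (gm_sum (ctens (watts S) W))).
have := dcomp_in (gm_sum (ctens (watts S) W)) y t.
have : wnat S W (dcomp (gm_comp (ctens (watts S) W)) y t) = 0.
  by rewrite grhom_dcomp t0 (dcomp0 (gm_sum (S W))).
move: (dcomp _ y t) => {t0}{}t t0 yt.
have [d [x [w [p [Hw Hp Ew]]]]] := unit_decomp y.
suff H' : cval t = \sum_(i < d) eps W (fm T (hat y (wnat S W t)) (w i)) \ot p i.
  apply: cval_inj; rewrite H' t0 big1 // => i _.
  by rewrite hat_eq0 ?fm0 ?(dcomp0 (gm_sum (S W))) // grhom0 tens_mk0l.
move: t yt {t0}; apply: ctens_comp_ind => [|z v m t zv zym IH].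
  rewrite grhom0 big1 // => i _.
  by rewrite hat_eq0 ?fm0 ?(dcomp0 (gm_sum (S W))) // grhom0 tens_mk0l.
rewrite cvalD {}IH grhomD (cval_cmk zv zym).
under [RHS]eq_bigr => i _ do rewrite hat_add fmD grhomD tens_mkDl.
rewrite big_split /=; congr (_ + _).
(* The expansion of [m] has coefficients in A, which move across the tensor sign onto [v]. *)
rewrite {1}(unit_col Hw Hp Ew (gb_col_comp zym)) tens_mk_sumr.
apply: eq_bigr => i _; rewrite -tens_mkA; congr (_ \ot _).
rewrite (wnat_cmk zv (gb_row_comp zym)) (wpair_hom _ zv) -hat_comp fm_comp epsn.
by rewrite (wpsi_tinj _ zym) hatE (dcomp_id (gm_sum W) zv).
Qed.

End WattsPairing.

(** The adjunction with S on the left makes the natural map onto; the one with T on the left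
    supplies the pairing and its dual bases, and thereby injectivity. *)
Lemma watts_theorem (k : comPzRingType) (G H : groupType) (A : galg k G) (B : galg k H)
    (X : rset G) (Y : rset H) (S : linfunctor (gr A X) (gr B Y))
    (T : linfunctor (gr B Y) (gr A X)) :
  left_adjoint S T -> left_adjoint T S ->
  functor_iso S (ctens_functor (watts S)) /\
  exists2 psi : watts S -> watts T -> A, graded_pairing psi & forall y, dual_bases psi y.
Proof.
move=> adjST /gr_adjointP[eta [eps [etan epsn epsT etaS]]].
have wS W v : exists t, wnat S W t = v := wnat_surj adjST v.
split.
  apply: functor_iso_sym.
  apply: (functor_iso_bij (F := ctens_functor (watts S)) (u := wnat S)) => [V W f v|W v|W t].
  - exact: wnat_natural.
  - exact: wS.
  - exact: (wnat_inj etan epsn etaS wS).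
exists (wpsi eps); first exact: wpsi_pairing epsn.
exact: (wpsi_bases etan epsn epsT etaS wS).
Qed.

Theorem theorem2p5p11 (k : comPzRingType) (G G' : groupType)
    (A : galg k G) (A' : galg k G') (X : rset G) (X' : rset G')
    (S : linfunctor (gr A X) (gr A' X')) (T : linfunctor (gr A' X') (gr A X)) :
  frobenius_pair S T <->
  exists (M : grbimod A A' X X') (N : grbimod A' A X' X),
  [/\ (forall x : X, fgproj (submod_of (gb_row_mod M x)) /\
                     fgproj (submod_of (gb_col_mod N x))) /\
      (forall x' : X', fgproj (submod_of (gb_col_mod M x')) /\
                       fgproj (submod_of (gb_row_mod N x'))),
      graded_iso (gdual_comp M) (gb_comp N) /\
      graded_iso (gdual_comp N) (gb_comp M)
    & functor_iso S (ctens_functor M) /\ functor_iso T (ctens_functor N)].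
Proof.
split=> [[adjTS adjST]|[M [N [[rM cM] [MN NM] [SM TN]]]]].
  have [SM [phi phiP phi_bases]] := watts_theorem adjST adjTS.
  have [TN [psi psiP psi_bases]] := watts_theorem adjTS adjST.
  exists (watts S), (watts T); split; split=> //.
  (* The pairing [phi] of M with N has dual bases indexed by X', and [psi], of N with M, has them
     indexed by X; so [psi] governs M's rows and N's columns. *)
  - move=> x; split; first exact: gp_fgproj_row psiP psi_bases x.
    exact: gp_fgproj_col psiP psi_bases x.
  - move=> x'; split; first exact: gp_fgproj_col phiP phi_bases x'.
    exact: gp_fgproj_row phiP phi_bases x'.
  - exact: gp_graded_iso phiP phi_bases.
  exact: gp_graded_iso psiP psi_bases.
(* Each duality isomorphism gives one adjunction: [phi] makes T left adjoint to S, and [psi] makes S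
   left adjoint to T. *)
have [phi phiP phi_bases] := gdual_iso_pairing (fun x' => (cM x').1) MN.
have [psi psiP psi_bases] := gdual_iso_pairing (fun x => (rM x).2) NM.
split.
- apply: left_adjoint_iso (functor_iso_sym TN) (functor_iso_sym SM) _.
  exact: pairing_adjoint phiP phi_bases.
apply: left_adjoint_iso (functor_iso_sym SM) (functor_iso_sym TN) _.
exact: pairing_adjoint psiP psi_bases.
Qed.
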